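(* Let $1\le k\le n$, let $A$ be a generic real symmetric $n\times n$ matrix and let $Z$ be an $n\times k$ matrix of variables. Consider the optimization problem of minimizing/maximizing $\operatorname{trace}(Z^TAZ)$ subject to $Z^TZ=\mathrm{Id}_k$. The algebraic set of its complex critical points is $$\bigsqcup_{\{i_1,\ldots,i_k\}\in\binom{[n]}{k}}\{[u_{i_1}\,u_{i_2}\,\cdots\,u_{i_k}]\,Q\;:\;Q\in \mathrm{O}(k)\},$$ where $u_1,\ldots,u_n$ is an orthonormal eigenbasis of $A$. This algebraic set is a disjoint union of $\binom{n}{k}$ varieties isomorphic to $\mathrm{O}(k)$; it has dimension $\dim(\mathrm{O}(k))=\binom{k}{2}$ and degree $\deg(\mathrm{O}(k))\binom{n}{k}$.
   Context: $[n]=\{1,\dots,n\}$ and $\binom{[n]}{k}$ is the set of $k$-element subsets of $[n]$. $\mathrm{O}(k)=\{Q\in\mathbb{C}^{k\times k}: Q^TQ=\mathrm{Id}_k\}$ is the complex orthogonal group, viewed as an affine variety in $\mathbb{A}^{k^2}$. A complex critical point of the problem is a matrix $Z\in\mathbb{C}^{n\times k}$ with $Z^TZ=\mathrm{Id}_k$ such that the gradient of the objective function $\operatorname{trace}(Z^TAZ)$ at $Z$ lies in the linear span of the gradients at $Z$ of the polynomials given by the entries of $Z^TZ-\mathrm{Id}_k$. ''Generic'' means: for all $A$ outside some proper Zariski closed subset of the space of symmetric matrices. The degree of an affine algebraic set is taken with respect to its given embedding in affine space (here $\mathbb{A}^{nk}$ for the critical set, and $\mathbb{A}^{k^2}$ for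 $\mathrm{O}(k)$). *)

(* Defs.v *)
From mathcomp Require Import all_boot all_order all_algebra.
From mathcomp Require Import boolp classical_sets functions cardinality reals.
From mathcomp Require Import complex.
From mathcomp Require Import mpoly.

Set Implicit Arguments.
Unset Strict Implicit.
Unset Printing Implicit Defensive.

Import GRing.Theory.
Local Open Scope classical_set_scope.
Local Open Scope ring_scope.

(** * Affine algebraic geometry in spaces of matrices

  The space 'M[F]_(m, n) is regarded as the affine space of dimension m * n:
  the (i, j) entry is the coordinate number [mxvec_index i j]. *)

Definition pval (F : fieldType) (m n : nat) (Z : 'M[F]_(m, n))
    (p : {mpoly F[m * n]}) : F :=
  p.@[fun i => mxvec Z 0 i].

Definition zclosed (F : fieldType) (m n : nat) (X : set 'M[F]_(m, n)) : Prop :=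
  exists S : set {mpoly F[m * n]},
    X = [set Z | forall p, S p -> pval Z p = 0].

(* [V] is meant to be a linear subspace, whose Zariski topology is the one
   induced by the ambient space of matrices; so [V `&` W] below is an arbitrary
   proper Zariski closed subset of [V]. *)
Definition generically (F : fieldType) (m n : nat) (V : set 'M[F]_(m, n))
    (P : 'M[F]_(m, n) -> Prop) : Prop :=
  exists W : set 'M[F]_(m, n),
    [/\ zclosed W, ~ (V `<=` W) & forall M, V M -> ~ W M -> P M].

Definition zirreducible (F : fieldType) (m n : nat) (Y : set 'M[F]_(m, n)) :
    Prop :=
  Y !=set0 /\
  forall Y1 Y2 : set 'M[F]_(m, n), zclosed Y1 -> zclosed Y2 ->
    Y `<=` Y1 `|` Y2 -> Y `<=` Y1 \/ Y `<=` Y2.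

Definition zchain (F : fieldType) (m n : nat) (X : set 'M[F]_(m, n)) (d : nat) :
    Prop :=
  exists Y : nat -> set 'M[F]_(m, n),
    (forall i, (i <= d)%N -> [/\ zclosed (Y i), zirreducible (Y i) & Y i `<=` X])
    /\ (forall i, (i < d)%N -> Y i `<` Y i.+1).

(* Krull dimension; the empty set has no dimension. *)
Definition has_dim (F : fieldType) (m n : nat) (X : set 'M[F]_(m, n)) (d : nat) :
    Prop :=
  zchain X d /\ forall e, zchain X e -> (e <= d)%N.

(* Each column of [W] gives one affine-linear equation: its first entry is the
   constant term, the other ones are the coefficients of the coordinates. *)
Definition slice (F : fieldType) (m n d : nat) (W : 'M[F]_(1 + m * n, d)) :
    set 'M[F]_(m, n) :=
  [set Z | row_mx 1%:M (mxvec Z) *m W = 0].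

(* The degree, over an algebraically closed field, of an algebraic set of
   dimension [d]: its number of intersection points with a generic
   affine-linear subspace of codimension [d]. *)
Definition has_degree (F : closedFieldType) (m n : nat) (X : set 'M[F]_(m, n))
    (e : nat) : Prop :=
  exists d : nat, has_dim X d /\
    generically [set: 'M[F]_(1 + m * n, d)] (fun W => (X `&` slice W #= `I_e)%card).

Definition pmap_mx (F : fieldType) (m n p q : nat)
    (f : 'M[{mpoly F[m * n]}]_(p, q)) (Z : 'M[F]_(m, n)) : 'M[F]_(p, q) :=
  map_mx (pval Z) f.

Definition zisomorphic (F : fieldType) (m n p q : nat)
    (X : set 'M[F]_(m, n)) (Y : set 'M[F]_(p, q)) : Prop :=
  exists (f : 'M[{mpoly F[m * n]}]_(p, q)) (g : 'M[{mpoly F[p * q]}]_(m, n)),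
    (forall x, X x -> Y (pmap_mx f x) /\ pmap_mx g (pmap_mx f x) = x) /\
    (forall y, Y y -> X (pmap_mx g y) /\ pmap_mx f (pmap_mx g y) = y).

(** * The optimization problem *)

Definition symmetric_mx (F : fieldType) (n : nat) : set 'M[F]_n :=
  [set A | A^T = A].
Arguments symmetric_mx F n _ : clear implicits.

(* For k = n this is the complex orthogonal group when F is the field of
   complex numbers: the transpose is not conjugated. *)
Definition stiefel (F : fieldType) (n k : nat) : set 'M[F]_(n, k) :=
  [set Z | Z^T *m Z = 1%:M].

Definition orthogonal_group (F : fieldType) (k : nat) : set 'M[F]_k :=
  @stiefel F k k.
Arguments orthogonal_group F k _ : clear implicits.

Definition var_mx (F : fieldType) (n k : nat) : 'M[{mpoly F[n * k]}]_(n, k) :=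
  \matrix_(i, j) 'X_(mxvec_index i j).

Definition objective (F : fieldType) (n k : nat) (A : 'M[F]_n) :
    {mpoly F[n * k]} :=
  \tr ((var_mx F n k)^T *m map_mx (@mpolyC (n * k) F) A *m var_mx F n k).

Definition constraint (F : fieldType) (n k : nat) (a b : 'I_k) :
    {mpoly F[n * k]} :=
  ((var_mx F n k)^T *m var_mx F n k - 1%:M) a b.

Definition gradient (F : fieldType) (n k : nat) (p : {mpoly F[n * k]})
    (Z : 'M[F]_(n, k)) : 'M[F]_(n, k) :=
  \matrix_(i, j) pval Z (p^`M(mxvec_index i j)).

Definition critical_points (F : fieldType) (n k : nat) (A : 'M[F]_n) :
    set 'M[F]_(n, k) :=
  [set Z | stiefel Z /\
     gradient (objective k A) Z \in
       <<[seq gradient (constraint F n ab.1 ab.2) Z | ab : 'I_k * 'I_k]>>%VS].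

Arguments critical_points {F n} k A _.

(** * Eigenvectors *)

Definition orthonormal_eigenbasis (F : fieldType) (n : nat) (A : 'M[F]_n)
    (u : 'I_n -> 'cV[F]_n) : Prop :=
  (forall i j, (u i)^T *m u j = (i == j)%:R%:M) /\
  (forall i, exists l : F, A *m u i = l *: u i).

(* If #|I| = k, the matrix whose columns are the [u i] for [i] in [I], in
   increasing order; the default value of [nth] is then never used. *)
Definition columns_of (F : fieldType) (n k : nat) (u : 'I_n -> 'cV[F]_n)
    (I : {set 'I_n}) : 'M[F]_(n, k) :=
  \matrix_(r, j) u (nth r (enum I) j) r 0.

Definition complexify (R : realType) (m n : nat) (M : 'M[R]_(m, n)) :
    'M[R[i]]_(m, n) :=
  map_mx (fun x : R => x%:C%C) M.

Definition component (R : realType) (n k : nat) (u : 'I_n -> 'cV[R]_n)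
    (I : {set 'I_n}) : set 'M[R[i]]_(n, k) :=
  [set complexify (columns_of k u I) *m Q | Q in orthogonal_group R[i] k].
Arguments component {R n} k u I _.

(* Main.v *)
From HB Require Import structures.
Require Import Defs.
From mathcomp Require Import all_boot all_order all_algebra.
From mathcomp Require Import boolp classical_sets functions cardinality reals.
From mathcomp Require Import complex.
From mathcomp Require Import closed_field mpoly.
Set Implicit Arguments.
Unset Strict Implicit.
Unset Printing Implicit Defensive.
Import Order.TTheory GRing.Theory Num.Theory.
Local Open Scope classical_set_scope.
Local Open Scope ring_scope.

(** Why the theorem holds.

  Write Z for an n x k matrix with Z^T Z = 1.  The gradient of trace(Z^T A Z) is
  2 A Z, and the gradients of the constraints are the matrices Z (E_ab + E_ba);
  so Z is critical exactly when A Z = Z S for some symmetric S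
  ([critical_pointsP]).  In the coordinates Y of an orthonormal eigenbasis, the
  projector Y Y^T then commutes with the diagonal matrix of the eigenvalues.
  When these are distinct, Y Y^T is diagonal, hence a 0-1 diagonal matrix of
  trace k: it selects k eigenvectors, and Z is an orthonormal frame of their span
  ([critical_span_frames]).  The eigenvalues are distinct when det p'(A) <> 0,
  where p is the characteristic polynomial of A ([discriminant_mx_conj]); this is
  the genericity condition, and diag(0, ..., n-1) shows that it is not void.

  Each component is the image of O(k) under Z |-> C Z, where C has a left
  inverse, so everything reduces to two facts on O(k): its dimension is
  d = k(k-1)/2, and it has a degree.  Both come from the Cayley transform
  S |-> (1 - S)(1 + S)^-1, which maps an open set of the d-dimensional space of
  skew matrices onto the orthogonal matrices Q with det(1 + Q) <> 0.  Up to a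
  diagonal matrix of signs every orthogonal matrix is of this kind
  ([det_add_signs]), so O(k) is covered by finitely many rational images of the
  affine d-space ([orthogonal_rational_cover]).

  Upper bound on the dimension.  More than d rational functions of d variables
  are algebraically dependent, by counting monomials ([alg_dep]); so more than d
  polynomials are dependent on a covered set ([rational_cover_dep]).  On the other
  hand a chain Y_0 < ... < Y_e of irreducible closed sets yields e independent
  polynomials, the i-th one vanishing on Y_(i-1) but not on Y_i
  ([chain_independent]).  Lower bound: the closures of the Cayley images of the
  coordinate subspaces of skew matrices form a chain of length d
  ([orthogonal_zchain]).

  Degree.  Let W be the system of d affine equations of a slice.  One coordinate
  of the point, the d linear forms and their coefficients are one more than there
  are parameters, so they satisfy an algebraic relation.  On the slice each linear
  form is minus the constant term of its equation, so this relation is a nonzero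
  equation for each coordinate, with coefficients polynomial in W
  ([rational_cover_slice]).  Hence a generic slice has a bounded number of points
  ([finite_slice]).  By quantifier elimination the set of the W whose slice has at
  least c points is constructible, so it or its complement contains a nonempty
  open set ([generic_has_points]).  The largest c for which it does is then the
  number of points of a generic slice ([has_degree_exists]).  Finally, slices of
  a component of the critical set pull back to slices of O(k), and the pullback of
  equations W is linear and onto ([generic_slice_mul]); adding up the C(n, k)
  disjoint components multiplies the degree by C(n, k)
  ([critical_has_degree]). *)

(** * Nonvanishing points of multivariate polynomials *)

Lemma widen_ord_lift n (i : 'I_n) : widen_ord (leqnSn n) i = lift ord_max i.
Proof. by apply/val_inj; rewrite /= /bump leqNgt ltn_ord. Qed.

Lemma mpoly_no_var (R : nzRingType) (p : {mpoly R[0]}) : p = (p@_0)%:MP.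
Proof.
apply/msize1_polyC; rewrite msizeE; apply/bigmax_leqP_seq => m _ _.
by rewrite mdegE big_ord0.
Qed.

Lemma meval_muni (R : comNzRingType) (n : nat) (p : {mpoly R[n.+1]}) v :
  p.@[v] =
  (map_poly (meval (fun i => v (widen_ord (leqnSn n) i))) (muni p)).[v ord_max].
Proof.
rewrite muniE mevalE raddf_sum horner_sum; apply: eq_bigr => m _.
rewrite /= map_polyZ /= map_polyXn hornerZ hornerXn mevalZ -mulrA; congr (_ * _).
rewrite mevalX big_ord_recr /=; congr (_ * _).
by apply: eq_bigr => i _; rewrite mnmE.
Qed.

Lemma muni_eq0 (R : comNzRingType) (n : nat) (p : {mpoly R[n.+1]}) :
  (muni p == 0) = (p == 0).
Proof.
apply/eqP/eqP=> [p0|->]; last exact: muni0.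
apply/mpolyP=> m; rewrite mcoeff0.
have [|] := boolP (m \in msupp p); last by move/memN_msupp_eq0.
move=> mp; have := congr1 (fun q : {poly {mpoly R[n]}} =>
  (q`_(m ord_max))@_[multinom m (widen_ord (leqnSn n) i) | i < n]) p0.
rewrite muniE coef0 mcoeff0 coef_sum raddf_sum /= (bigD1_seq m) ?msupp_uniq //=.
rewrite coefZ coefXn eqxx mulr1 mcoeffZ mcoeffX eqxx mulr1.
rewrite big1 ?addr0 // => m' m'm.
rewrite coefZ coefXn; case: (altP (_ =P m' ord_max)) => e; last by rewrite mulr0 mcoeff0.
rewrite mulr1 mcoeffZ mcoeffX; case: (altP (_ =P _)) => e'; last by rewrite mulr0.
case/eqP: m'm; apply/mnmP=> i.
have [j ->|->] := unliftP ord_max i; last by [].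
by move/mnmP: e' => /(_ j); rewrite !mnmE widen_ord_lift.
Qed.

Section InfiniteField.
Variable F : closedFieldType.

(** By induction on the number of variables: the leading coefficient in the last
  variable does not vanish at some point, which leaves a nonzero univariate
  polynomial. *)
Lemma mpoly_nonroot n (p : {mpoly F[n]}) : p != 0 -> exists v, p.@[v] != 0.
Proof.
elim: n p => [|n IHn] p p0.
  exists (fun=> 0); apply: contra_neq p0 => e.
  by move: e; rewrite (mpoly_no_var p) mevalC => ->.
have /IHn[v vP] : lead_coef (muni p) != 0 by rewrite lead_coef_eq0 muni_eq0.
have q0 : map_poly (meval v) (muni p) != 0.
  apply: contra_neq vP => /(congr1 (fun q : {poly F} => q`_(size (muni p)).-1)).
  by rewrite coef_map coef0.
have [x /negP x0] := closed_nonrootP _ q0.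
pose w (i : 'I_n.+1) := if unlift ord_max i is Some j then v j else x.
exists w; apply/negP => e; apply: x0; rewrite rootE -(eqP e) meval_muni.
rewrite {2}/w unlift_none; apply/eqP; congr (_.[x]).
by apply: eq_map_poly => q; apply: meval_eq => j; rewrite /w widen_ord_lift liftK.
Qed.

Lemma meval_line n (p : {mpoly F[n]}) v w :
  exists q : {poly F}, forall t, q.[t] = p.@[fun i => v i + t * (w i - v i)].
Proof.
exists (mmap polyC (fun i => (v i)%:P + 'X * (w i - v i)%:P) p) => t.
rewrite mevalE /mmap horner_sum; apply: eq_bigr => m _.
rewrite hornerM hornerC; congr (_ * _).
rewrite /mmap1 horner_prod; apply: eq_bigr => i _.
by rewrite horner_exp !hornerE.
Qed.

(** Restricting to the line through the two points gives two nonzero univariate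
  polynomials, whose product is nonzero.  Irreducibility of affine spaces
  is only used in this form. *)
Lemma common_nonroot n (p q : {mpoly F[n]}) v w :
    p.@[v] != 0 -> q.@[w] != 0 ->
  exists t, p.@[fun i => v i + t * (w i - v i)] != 0 /\
            q.@[fun i => v i + t * (w i - v i)] != 0.
Proof.
move=> pv qw; have [P PE] := meval_line p v w; have [Q QE] := meval_line q v w.
have P0 : P != 0.
  apply: contra_neq pv => P0; have := PE 0; rewrite P0 horner0 => ->.
  by apply: meval_eq => i; rewrite mul0r addr0.
have Q0 : Q != 0.
  apply: contra_neq qw => Q0; have := QE 1; rewrite Q0 horner0 => ->.
  by apply: meval_eq => i; rewrite mul1r addrC subrK.
have [t] := closed_nonrootP _ (mulf_neq0 P0 Q0).
by rewrite rootM negb_or /root PE QE => /andP[Pt Qt]; exists t.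
Qed.

End InfiniteField.

(** * Zariski closed sets and genericity in spaces of matrices *)

HB.instance Definition _ (F : fieldType) m n (Z : 'M[F]_(m, n)) :=
  GRing.RMorphism.copy (pval Z) (meval (fun i => mxvec Z 0 i)).

Section Zariski.
Variable F : fieldType.

Lemma pvalX m n (Z : 'M[F]_(m, n)) i j : pval Z 'X_(mxvec_index i j) = Z i j.
Proof. by rewrite /pval mevalXU mxvecE. Qed.

Lemma pval_vec_mx m n (v : 'I_(m * n) -> F) p :
  pval (vec_mx (\row_i v i)) p = p.@[v].
Proof. by apply: meval_eq => i; rewrite vec_mxK mxE. Qed.

Lemma zclosedI m n (X Y : set 'M[F]_(m, n)) :
  zclosed X -> zclosed Y -> zclosed (X `&` Y).
Proof.
move=> [S ->] [T ->]; exists (S `|` T); apply/seteqP; split=> Z /=.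
  by move=> [ZS ZT] p [/ZS|/ZT].
by move=> ZST; split=> p pS; apply: ZST; [left|right].
Qed.

(** The products of an equation of X by an equation of Y cut out the union. *)
Lemma zclosedU m n (X Y : set 'M[F]_(m, n)) :
  zclosed X -> zclosed Y -> zclosed (X `|` Y).
Proof.
move=> [S ->] [T ->]; exists [set p * q | p in S & q in T].
apply/seteqP; split=> Z /=.
  by move=> ZST _ [p pS [q qT <-]]; rewrite rmorphM /=; case: ZST => [/(_ p pS)|/(_ q qT)] ->;
     rewrite ?mul0r ?mulr0.
move=> ZST; apply: contrapT => /not_orP[/existsNP[p /not_implyP[pS /eqP Zp]]].
case/existsNP=> q /not_implyP[qT /eqP Zq].
have /ZST : exists2 x, S x & exists2 y, T y & x * y = p * q by exists p; last exists q.
by rewrite rmorphM /= => /eqP; rewrite mulf_eq0 (negbTE Zp) (negbTE Zq).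
Qed.

Lemma zclosed0 m n : zclosed (@set0 'M[F]_(m, n)).
Proof.
exists [set 1]; apply/seteqP; split=> Z //= /(_ 1 erefl).
by rewrite /pval meval1 => /eqP; rewrite oner_eq0.
Qed.

Lemma zclosed_bigcup m n (I : finType) (D : set I) (X : I -> set 'M[F]_(m, n)) :
  (forall i, D i -> zclosed (X i)) -> zclosed (\bigcup_(i in D) X i).
Proof.
move=> Xc; have -> : \bigcup_(i in D) X i = \big[setU/set0]_(i <- enum I | `[< D i >]) X i.
  rewrite -bigcup_seq_cond; apply/seteqP; split=> Z [i Di Zi]; exists i => //=.
    by rewrite /= mem_enum /= ; apply/asboolP.
  by case/andP: Di => _ /asboolP.
by elim/big_ind: _ => [|Y Z|i /asboolP /Xc//]; [exact: zclosed0|exact: zclosedU].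
Qed.

Lemma zclosed_poly m n (p : {mpoly F[m * n]}) : zclosed [set Z | pval Z p = 0].
Proof. by exists [set p]; apply/seteqP; split=> Z /= => [Zp _ ->|]; last exact. Qed.

Lemma zclosed_polys m n p q (f : 'M[{mpoly F[m * n]}]_(p, q)) :
  zclosed [set Z | pmap_mx f Z = 0].
Proof.
exists [set f ij.1 ij.2 | ij in [set: 'I_p * 'I_q]].
apply/seteqP; split=> Z /=.
  by move=> /matrixP Zf _ [[i j] _ <-]; have := Zf i j; rewrite !mxE.
by move=> Zf; apply/matrixP=> i j; rewrite !mxE; apply: Zf; exists (i, j).
Qed.

Lemma pval_comp m n p q (f : 'M[{mpoly F[m * n]}]_(p, q)) (r : {mpoly F[p * q]}) :
  exists s, forall Z, pval Z s = pval (pmap_mx f Z) r.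
Proof.
exists (r \mPo [tuple mxvec f 0 i | i < p * q]) => Z.
rewrite /pval comp_mpoly_meval; apply: meval_eq => i.
by rewrite tnth_mktuple; case/mxvec_indexP: i => i j; rewrite !mxvecE mxE.
Qed.

Lemma zclosed_preim m n p q (f : 'M[{mpoly F[m * n]}]_(p, q)) (X : set 'M[F]_(p, q)) :
  zclosed X -> zclosed [set Z | X (pmap_mx f Z)].
Proof.
move=> [S ->]; exists [set s | exists2 r, S r & forall Z, pval Z s = pval (pmap_mx f Z) r].
apply/seteqP; split=> Z /=; first by move=> ZS s [r rS ->]; exact: ZS.
move=> ZS r rS; have [s sE] := pval_comp f r.
by rewrite -sE; apply: ZS; exists r.
Qed.

Lemma pmap_mxM m n p q r (Z : 'M[F]_(m, n)) (f : 'M_(p, q)) (g : 'M_(q, r)) :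
  pmap_mx (f *m g) Z = pmap_mx f Z *m pmap_mx g Z.
Proof. exact: map_mxM. Qed.

Lemma pmap_mxB m n p q (Z : 'M[F]_(m, n)) (f g : 'M_(p, q)) :
  pmap_mx (f - g) Z = pmap_mx f Z - pmap_mx g Z.
Proof. exact: map_mxB. Qed.

Lemma pmap_mx1 m n p (Z : 'M[F]_(m, n)) : pmap_mx (1%:M : 'M_p) Z = 1%:M.
Proof. exact: map_mx1. Qed.

Lemma pmap_mxT m n p q (Z : 'M[F]_(m, n)) (f : 'M_(p, q)) :
  pmap_mx f^T Z = (pmap_mx f Z)^T.
Proof. by rewrite /pmap_mx map_trmx. Qed.

Lemma pmap_mxC m n p q (Z : 'M[F]_(m, n)) (A : 'M_(p, q)) :
  pmap_mx (map_mx (@mpolyC (m * n) F) A) Z = A.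
Proof. by apply/matrixP=> i j; rewrite !mxE /pval mevalC. Qed.

Lemma pmap_var m n (Z : 'M[F]_(m, n)) : pmap_mx (var_mx F m n) Z = Z.
Proof. by apply/matrixP=> i j; rewrite !mxE pvalX. Qed.

Definition mul_var p m n (A : 'M[F]_(p, m)) : 'M[{mpoly F[m * n]}]_(p, n) :=
  map_mx (@mpolyC (m * n) F) A *m var_mx F m n.

Lemma pmap_mul_var p m n (A : 'M[F]_(p, m)) (Z : 'M[F]_(m, n)) :
  pmap_mx (mul_var n A) Z = A *m Z.
Proof. by rewrite pmap_mxM pmap_mxC pmap_var. Qed.

Lemma zclosed_mul_preim p m n (A : 'M[F]_(p, m)) (X : set 'M[F]_(p, n)) :
  zclosed X -> zclosed [set Z : 'M[F]_(m, n) | X (A *m Z)].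
Proof.
move=> /(zclosed_preim (mul_var n A)); congr zclosed.
by apply/seteqP; split=> Z /=; rewrite pmap_mul_var.
Qed.

Lemma stiefelE m n :
  @stiefel F m n = [set Z | pmap_mx ((var_mx F m n)^T *m var_mx F m n - 1%:M) Z = 0].
Proof.
apply/esym/seteqP; split=> Z /=;
  rewrite !(pmap_mxB, pmap_mxM, pmap_mxT, pmap_mx1, pmap_var).
  by move/eqP; rewrite subr_eq0 => /eqP.
by move=> ZZ; apply/eqP; rewrite subr_eq0; apply/eqP.
Qed.

Lemma zclosed_stiefel m n : zclosed (@stiefel F m n).
Proof. by rewrite stiefelE; apply: zclosed_polys. Qed.

End Zariski.

Section Genericity.
Variable F : closedFieldType.

(** Only one equation of the excluded closed set matters, so genericity in the
  whole space is the nonvanishing of one nonzero polynomial. *)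
Lemma genericallyP m n (P : 'M[F]_(m, n) -> Prop) :
  generically [set: 'M[F]_(m, n)] P <->
  exists2 p : {mpoly F[m * n]}, p != 0 & forall Z, pval Z p != 0 -> P Z.
Proof.
split=> [[W [[S WS] WT WP]]|[p p0 pP]].
  have /existsNP[Z /not_implyP[_]] := WT; rewrite WS.
  move=> /existsNP[p /not_implyP[pS /eqP Zp]].
  exists p; first by apply: contra_neq Zp => ->; rewrite /pval meval0.
  by move=> Z' Z'p; apply: WP => //; rewrite WS => /(_ p pS) /eqP; apply/negP.
exists [set Z | pval Z p = 0]; split; first exact: zclosed_poly.
  have [v vp] := mpoly_nonroot p0.
  move=> /(_ (vec_mx (\row_i v i)) I) /=; rewrite pval_vec_mx => /eqP.
  exact/negP.
by move=> Z _ /eqP; apply: pP.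
Qed.

Lemma generically_sub m n (P Q : 'M[F]_(m, n) -> Prop) :
  (forall Z, P Z -> Q Z) ->
  generically [set: 'M[F]_(m, n)] P -> generically [set: 'M[F]_(m, n)] Q.
Proof. by move=> PQ [W [Wc WT WP]]; exists W; split=> // Z _ /WP => /(_ I)/PQ. Qed.

Lemma generically_and m n (P Q : 'M[F]_(m, n) -> Prop) :
  generically [set: 'M[F]_(m, n)] P -> generically [set: 'M[F]_(m, n)] Q ->
  generically [set: 'M[F]_(m, n)] (fun Z => P Z /\ Q Z).
Proof.
move=> /genericallyP[p p0 pP] /genericallyP[q q0 qQ]; apply/genericallyP.
exists (p * q); first exact: mulf_neq0.
by move=> Z; rewrite rmorphM /= mulf_eq0 negb_or => /andP[/pP ? /qQ ?].
Qed.

Lemma generically_all m n (I : eqType) (s : seq I) (P : I -> 'M[F]_(m, n) -> Prop) :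
  (forall i, i \in s -> generically [set: 'M[F]_(m, n)] (P i)) ->
  generically [set: 'M[F]_(m, n)] (fun Z => forall i, i \in s -> P i Z).
Proof.
elim: s => [_|i s IHs sP].
  by apply/genericallyP; exists 1; rewrite ?oner_eq0.
have /IHs : forall j, j \in s -> generically [set: 'M_(m, n)] (P j).
  by move=> j js; apply: sP; rewrite inE js orbT.
move: (sP i (mem_head _ _)) => /generically_and /[apply].
by apply: generically_sub => Z [Pi Ps] j; rewrite inE => /predU1P[->|/Ps].
Qed.

Lemma generically_pullback m n p q (f : 'M[{mpoly F[m * n]}]_(p, q)) P :
    (forall Y, exists Z, pmap_mx f Z = Y) ->
  generically [set: 'M[F]_(p, q)] P ->
  generically [set: 'M[F]_(m, n)] (fun Z => P (pmap_mx f Z)).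
Proof.
move=> f_surj [W [Wc WT WP]]; exists [set Z | W (pmap_mx f Z)].
split; first exact: zclosed_preim.
  by move=> WfT; apply: WT => Y _; have [Z <-] := f_surj Y; apply: WfT.
by move=> Z _; apply: WP.
Qed.

End Genericity.

(** * Algebraic dependence of rational functions *)

Section Dependence.
Variable F : fieldType.

Lemma msize_mul_le n (p q : {mpoly F[n]}) : (msize (p * q) <= msize p + msize q)%N.
Proof.
have [->|p0] := eqVneq p 0; first by rewrite mul0r msize0.
have [->|q0] := eqVneq q 0; first by rewrite mulr0 msize0.
by rewrite msizeM // leq_pred.
Qed.

Lemma msize_exp n (p : {mpoly F[n]}) k : (msize (p ^+ k) <= (msize p * k).+1)%N.
Proof.
elim: k => [|k IHk]; first by rewrite expr0 msize1.
rewrite exprS; apply: leq_trans (msize_mul_le _ _) _.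
by rewrite mulnS -addnS leq_add2l.
Qed.

Lemma msize_prod_le n (I : Type) (s : seq I) (p : I -> {mpoly F[n]}) b :
  (forall i, msize (p i) <= b)%N ->
  (msize (\prod_(i <- s) p i) <= (b * size s).+1)%N.
Proof.
move=> pb; elim: s => [|i s IHs]; first by rewrite big_nil msize1.
rewrite big_cons; apply: leq_trans (msize_mul_le _ _) _.
by rewrite /= mulnS -addnS leq_add.
Qed.

(** The products of the P_i / q with exponents below T are T^r in number, and
  over a common power of q their numerators have degree O(T): they live in a
  space of dimension O(T^d).  As r > d, for T large there are more products than
  dimensions, and a linear relation between them is an algebraic relation. *)
Lemma alg_dep d r (P : 'I_r -> {mpoly F[d]}) (q : {mpoly F[d]}) : (d < r)%N ->
  exists2 G : {mpoly F[r]}, G != 0 &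
    forall s, q.@[s] != 0 -> G.@[fun i => (P i).@[s] / q.@[s]] = 0.
Proof.
move=> dr.
(* T is large enough for T^r > L^d, where L bounds the exponents in the H al. *)
pose b := (\max_i msize (P i) + msize q)%N.
pose c := ((b + 2) * r)%N.
pose T := ((c.+1 ^ d).+1)%N.
pose L := (T * c.+1)%N.
pose A := {ffun 'I_r -> 'I_T}; pose B := {ffun 'I_d -> 'I_L}.
pose H (al : A) := \prod_i (P i ^+ al i * q ^+ (T - al i)).
pose mon k l (be : {ffun 'I_k -> 'I_l}) := [multinom (be i : nat) | i < k].
have H_small (al : A) : (msize (H al) <= L)%N.
  rewrite /H -big_enum /=.
  have : (forall i, msize (P i ^+ al i * q ^+ (T - al i)) <= T * (b + 2))%N.
    move=> i; apply: leq_trans (msize_mul_le _ _) _.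
    apply: leq_trans (leq_add (msize_exp _ _) (msize_exp _ _)) _.
    have /leq_trans -> // : ((msize (P i) * al i).+1 + (msize q * (T - al i)).+1 <=
       b * T + 2)%N.
      rewrite addnS addSn addn2 !ltnS.
      have le1 : (msize (P i) <= b)%N by apply: leq_trans (leq_addr _ _); apply: leq_bigmax.
      have le2 : (msize q <= b)%N by apply: leq_addl.
      apply: leq_trans (leq_add (leq_mul le1 (leqnn _)) (leq_mul le2 (leqnn _))) _.
      by rewrite -mulnDr subnKC // ltnW // ltn_ord.
    by rewrite mulnDr (mulnC b) leq_add2l leq_pmull.
  move=> /(msize_prod_le (enum 'I_r)) /leq_trans -> //.
  by rewrite size_enum_ord /L /c mulnS mulnA -add1n leq_add2r.
pose M := \matrix_(i < #|{: A}|, j < #|{: B}|) (H (enum_val i))@_(mon _ _ (enum_val j)).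
have MK : kermx M != 0.
  rewrite kermx_eq0; apply/negP => /eqP eq_rk.
  have := rank_leq_col M; rewrite eq_rk !card_ffun !card_ord leqNgt => /negP; apply.
  apply: (@leq_trans (T ^ d.+1)%N); last by rewrite leq_exp2l // /T ltnS expn_gt0.
  by rewrite /L expnMn expnSr ltn_mul2l expn_gt0 /=.
pose u := nz_row (kermx M).
have u0 : u != 0 by rewrite nz_row_eq0.
have uM : u *m M = 0 by apply/sub_kermxP; apply: nz_row_sub.
have mon_inj k l : injective (mon k l).
  by move=> x y /mnmP e; apply/ffunP=> i; apply/val_inj; have := e i; rewrite !mnmE.
have sum0 : \sum_i u 0 i *: H (enum_val i) = 0.
  apply/mpolyP=> m; rewrite mcoeff0 raddf_sum /=.
  have [mL|Lm] := ltnP (mdeg m) L; last first.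
    rewrite big1 // => i _; rewrite mcoeffZ memN_msupp_eq0 ?mulr0 //.
    by apply: msize_mdeg_ge; apply: leq_trans Lm.
  have m_small i : (m i < L)%N.
    by apply: leq_ltn_trans mL; rewrite mdegE (bigD1 i) //= leq_addr.
  pose be : B := [ffun i => Ordinal (m_small i)].
  have /matrixP/(_ 0 (enum_rank be)) := uM; rewrite !mxE => uM0.
  rewrite -[RHS]uM0; apply: eq_bigr => i _; rewrite mcoeffZ !mxE enum_rankK.
  by congr (_ * _@__); apply/mnmP=> k; rewrite mnmE ffunE.
pose G : {mpoly F[r]} := \sum_i u 0 i *: 'X_[mon _ _ (enum_val i : A)].
exists G.
  have /matrix0Pn[i0 [a ua]] := u0; rewrite {i0}(ord1 i0) in ua.
  apply: contra_neq ua => /(congr1 (mcoeff (mon _ _ (enum_val a : A)))).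
  rewrite mcoeff0 raddf_sum /= (bigD1 a) //= mcoeffZ mcoeffX eqxx mulr1 big1 ?addr0 //.
  move=> i ia; rewrite mcoeffZ mcoeffX (inj_eq (@mon_inj _ _)) (inj_eq enum_val_inj).
  by rewrite (negbTE ia) mulr0.
move=> s qs; apply: (mulIf (expf_neq0 (T * r) qs)); rewrite mul0r.
rewrite -[RHS](meval0 s) -[in RHS]sum0 !raddf_sum /= mulr_suml; apply: eq_bigr => i _.
rewrite !mevalZ -mulrA; congr (_ * _).
rewrite mevalX /H rmorph_prod /= exprM.
have -> : (q.@[s] ^+ T) ^+ r = \prod_(i < r) q.@[s] ^+ T by rewrite prodr_const card_ord.
rewrite -big_split /=; apply: eq_bigr => k _; rewrite mnmE rmorphM !rmorphXn /=.
rewrite expr_div_n -mulrA; congr (_ * _).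
by rewrite mulrC -expfB // ltn_ord.
Qed.

(** The composite has denominator q^m as soon as m bounds the degree of p. *)
Lemma rational_comp d N (P : 'I_N -> {mpoly F[d]}) (q : {mpoly F[d]})
    (p : {mpoly F[N]}) m : (msize p <= m)%N ->
  exists p' : {mpoly F[d]}, forall s, q.@[s] != 0 ->
    p.@[fun i => (P i).@[s] / q.@[s]] = p'.@[s] / (q ^+ m).@[s].
Proof.
move=> pm; exists (\sum_(mo <- msupp p)
  p@_mo *: ((\prod_i P i ^+ mo i) * q ^+ (m - mdeg mo))) => s qs.
rewrite mevalE raddf_sum mulr_suml; apply: eq_big_seq => mo mop.
rewrite /= mevalZ mevalM rmorph_prod /= !rmorphXn /= -!mulrA; congr (_ * _).
have mom : (mdeg mo < m)%N by apply: leq_trans pm; apply: msize_mdeg_lt.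
have -> : q.@[s] ^+ (m - mdeg mo) / q.@[s] ^+ m = (q.@[s] ^+ mdeg mo)^-1.
  rewrite expfB // mulrAC mulfV ?mul1r // expf_neq0 //.
rewrite -exprVn mdegE -prodrXr -big_split /=; apply: eq_bigr => i _.
by rewrite exprMn rmorphXn.
Qed.

(** One common denominator q for all entries; the map is only meant where q does
  not vanish. *)
Definition rational_map d m n (P : 'M[{mpoly F[d]}]_(m, n)) (q : {mpoly F[d]})
    (s : 'I_d -> F) : 'M[F]_(m, n) :=
  map_mx (fun p => p.@[s] / q.@[s]) P.

(** Such a cover by charts bounds dimensions and slices from above, and it passes
  to finite unions, so that irreducible components are not needed. *)
Definition rational_cover m n (X : set 'M[F]_(m, n)) d :=
  exists (J : finType) (P : J -> 'M[{mpoly F[d]}]_(m, n)) (q : J -> {mpoly F[d]}),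
  forall Z, X Z -> exists j s, (q j).@[s] != 0 /\
    Z = rational_map (P j) (q j) s.

(** Each chart gives a relation; their product holds on all charts. *)
Lemma rational_cover_dep m n (X : set 'M[F]_(m, n)) d e (x : 'I_e -> {mpoly F[m * n]}) :
  rational_cover X d -> (d < e)%N ->
  exists2 G : {mpoly F[e]}, G != 0 & forall Z, X Z -> G.@[fun i => pval Z (x i)] = 0.
Proof.
move=> [J [P [q XPq]]] de.
pose D := \max_i msize (x i).
have /choice[x' x'E] (ji : J * 'I_e) : exists p', forall s, (q ji.1).@[s] != 0 ->
    (x ji.2).@[fun k => (mxvec (P ji.1) 0 k).@[s] / (q ji.1).@[s]] =
    p'.@[s] / ((q ji.1) ^+ D).@[s].
  exact/(rational_comp (fun k => mxvec (P ji.1) 0 k))/leq_bigmax.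
have /choice[G GP] (j : J) : exists G : {mpoly F[e]}, G != 0 /\
    forall s, (q j ^+ D).@[s] != 0 ->
      G.@[fun i => (x' (j, i)).@[s] / (q j ^+ D).@[s]] = 0.
  by have [G] := alg_dep (fun i => x' (j, i)) (q j ^+ D) de; exists G.
exists (\prod_j G j).
  by apply/prodf_neq0 => j _; have [] := GP j.
move=> Z /XPq[j [s [qs ->]]]; rewrite rmorph_prod /= (bigD1 j) //=.
have [_ /(_ s)] := GP j; rewrite rmorphXn expf_neq0 //= => /(_ isT) Gs.
apply/eqP; rewrite mulf_eq0; apply/orP; left; rewrite -[X in _ == X]Gs.
apply/eqP/meval_eq => i; have := x'E (j, i) s qs; rewrite rmorphXn /= => <-.
by apply: meval_eq => k; case/mxvec_indexP: k => a b; rewrite !mxvecE mxE.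
Qed.

End Dependence.

(** * Dimension and finiteness of slices *)

Section Dimension.
Variable F : fieldType.

Lemma zirreducible_mul m n (Y : set 'M[F]_(m, n)) p q :
  zirreducible Y -> (forall Z, Y Z -> pval Z p * pval Z q = 0) ->
  (forall Z, Y Z -> pval Z p = 0) \/ (forall Z, Y Z -> pval Z q = 0).
Proof.
move=> [_ Yirr] Ypq.
have := Yirr _ _ (zclosed_poly p) (zclosed_poly q); apply.
by move=> Z /Ypq/eqP; rewrite mulf_eq0 => /orP[]/eqP; [left|right].
Qed.

(** Evaluating at x all variables but one, and at p the last one, is again a
  polynomial function of the point Z. *)
Lemma horner_pval m n e (x : 'I_e -> {mpoly F[m * n]}) (p : {mpoly F[m * n]})
    (q : {poly {mpoly F[e]}}) :
  exists Q, forall Z : 'M[F]_(m, n),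
    pval Z Q = (map_poly (meval (fun i => pval Z (x i))) q).[pval Z p].
Proof.
exists ((map_poly (comp_mpoly [tuple x i | i < e]) q).[p]) => Z.
rewrite -[LHS](horner_map (meval (fun i => mxvec Z 0 i))) -map_poly_comp.
congr _.[_]; apply: eq_map_poly => r /=.
by rewrite comp_mpoly_meval; apply: meval_eq => i; rewrite tnth_mktuple.
Qed.

(** Choose x_i vanishing on Y_(i-1) but not on Y_i.  Given G <> 0, divide it by
  the largest power of its last variable, which does not vanish identically on
  the top set.  The quotient has a nonzero constant term in that variable, and on
  Y_(e-1), where the last x vanishes, it equals this term, so that induction
  applies.  As Y_e is irreducible, the product with the power of the last x does
  not vanish identically either. *)
Lemma chain_independent m n (Y : nat -> set 'M[F]_(m, n)) e :
    (forall i, (i <= e)%N -> zclosed (Y i) /\ zirreducible (Y i)) ->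
    (forall i, (i < e)%N -> Y i `<` Y i.+1) ->
  exists x : 'I_e -> {mpoly F[m * n]}, forall G : {mpoly F[e]}, G != 0 ->
    exists2 Z, Y e Z & G.@[fun i => pval Z (x i)] != 0.
Proof.
elim: e => [|e IHe] Yirr Ylt.
  have [_ [[Z YZ] _]] := Yirr 0%N (leqnn _).
  exists (fun=> 0) => G G0; exists Z => //; apply: contra_neq G0 => G0.
  by move: G0; rewrite (mpoly_no_var G) mevalC => ->.
have [|i ie|x xP] := IHe _ _.
- by move=> i ie; apply: Yirr; apply: leqW.
- by apply: Ylt; apply: leqW.
have [Ye_sub Ye_nsub] := Ylt e (leqnn _).
have [[S YeS] _] := Yirr e (leqnSn _).
have [p pe [Z1 Z1Y Z1p]] : exists2 p, (forall Z, Y e Z -> pval Z p = 0) &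
    exists2 Z, Y e.+1 Z & pval Z p != 0.
  apply: contrapT => noP; apply: Ye_nsub => Z YZ; rewrite YeS => p pS.
  apply: contrapT => /eqP Zp; apply: noP; exists p; last by exists Z.
  by move=> Z'; rewrite YeS; apply.
exists (fun i => if unlift ord_max i is Some j then x j else p) => G G0.
apply: contrapT => noZ.
have h0 : muni G != 0 by rewrite muni_eq0.
(* In the last variable, G is X^k q with q nonzero at X = 0. *)
have [k [q + hE]] := multiplicity_XsubC (muni G) 0.
rewrite h0 /= => q0.
have [Q QE] := horner_pval x p q.
have [_ /(@zirreducible_mul _ _ _ Q (p ^+ k))[]] := Yirr e.+1 (leqnn _).
- move=> Z YZ; apply: contrapT => /eqP Zn; apply: noZ; exists Z => //.
  apply: contra_neq Zn => GZ; rewrite -[RHS]GZ meval_muni hE rmorphM !rmorphXn /=.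
  rewrite map_polyXsubC hornerM horner_exp !hornerE raddf0 subr0.
  rewrite QE unlift_none; congr (_.[_] * _).
  by apply: eq_map_poly => r; apply: meval_eq => j; rewrite widen_ord_lift liftK.
- move=> Q0; have /xP[Z YZ] : q.[0] != 0 by [].
  move/eqP; apply; have := Q0 Z (Ye_sub _ YZ); rewrite QE pe // => <-.
  by rewrite -[in RHS](raddf0 (meval (fun i => pval Z (x i)))) horner_map.
move=> /(_ Z1 Z1Y) /eqP; rewrite [pval _ _]rmorphXn /=.
by apply/negP; rewrite expf_neq0.
Qed.

Lemma zchain_le m n (X : set 'M[F]_(m, n)) d e :
  rational_cover X d -> zchain X e -> (e <= d)%N.
Proof.
move=> Xd [Y [Yirr Ylt]]; rewrite leqNgt; apply/negP => de.
have [||x xP] := @chain_independent _ _ Y e; [|by []|].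
  by move=> i /Yirr[].
have [G G0 GX] := rational_cover_dep x Xd de.
have [Z YZ] := xP G G0.
by have [_ _ YX] := Yirr e (leqnn _); rewrite GX ?eqxx //; apply: YX.
Qed.

(** The parameters are a matrix of (1 + N) d variables, where N = m n: the first
  row holds the parameters s of a chart, the others hold the coefficients of the
  linear forms.  The constant terms -(coefficients) . Z(s), the coefficients, and
  one coordinate of Z(s) are (1 + N) d + 1 functions of these parameters, so they
  are dependent.  The relation does not forget W, since the constant terms and
  the coefficients together form the full matrix W of the slice. *)
Lemma rational_cover_slice m n (X : set 'M[F]_(m, n)) d : rational_cover X d ->
  exists2 h : {poly {mpoly F[(1 + m * n) * d]}}, h != 0 &
    forall W Z, X Z -> slice W Z -> forall a b, root (map_poly (pval W) h) (Z a b).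
Proof.
move=> [J [P [q XPq]]].
pose N := (m * n)%N; pose V := var_mx F (1 + N) d.
pose lift_s : {mpoly F[d]} -> {mpoly F[(1 + N) * d]} :=
  comp_mpoly [tuple V 0 l | l < d].
pose coefs j := col_mx (- (mxvec (map_mx lift_s (P j)) *m dsubmx V))
                       (lift_s (q j) *: dsubmx V).
pose f (jab : J * ('I_m * 'I_n)) (i : 'I_((1 + N) * d).+1) :=
  if unlift ord_max i is Some k then mxvec (coefs jab.1) 0 k
  else lift_s (P jab.1 jab.2.1 jab.2.2).
have /choice[G GP] jab : exists G : {mpoly F[((1 + N) * d).+1]}, G != 0 /\
    forall V', (lift_s (q jab.1)).@[V'] != 0 ->
      G.@[fun i => (f jab i).@[V'] / (lift_s (q jab.1)).@[V']] = 0.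
  by have [G] := alg_dep (f jab) (lift_s (q jab.1)) (leqnn _); exists G.
exists (\prod_jab muni (G jab)).
  by apply/prodf_neq0 => jab _; rewrite muni_eq0; have [] := GP jab.
move=> W Z /XPq[j [s [qs ZE]]] WZ a b.
rewrite rmorph_prod /= (bigD1 (j, (a, b))) //= rootM; apply/orP; left.
(* At these parameters the functions of the relation take the values Z a b and W. *)
pose V' := col_mx (\row_l s l) (dsubmx W) : 'M_(1 + N, d).
have liftE r : (lift_s r).@[fun i => mxvec V' 0 i] = r.@[s].
  rewrite comp_mpoly_meval; apply: meval_eq => l; rewrite tnth_mktuple mxE mevalXU mxvecE.
  have -> : (0 : 'I_(1 + N)) = lshift N 0 by apply/val_inj.
  by rewrite col_mxEu mxE.
have [_ /(_ (fun i => mxvec V' 0 i))] := GP (j, (a, b)).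
rewrite liftE => /(_ qs) GV; rewrite rootE -[X in _ == X]GV meval_muni /f /= unlift_none liftE.
have -> : (P j a b).@[s] / (q j).@[s] = Z a b by rewrite ZE mxE.
apply/eqP; congr (_.[_]); apply: eq_map_poly => r; apply: meval_eq => k.
rewrite widen_ord_lift liftK.
have coefsE : pmap_mx (coefs j) V' = (q j).@[s] *: W.
  rewrite /coefs /pmap_mx map_col_mx map_mxN map_mxM map_mxZ /=.
  have -> : map_mx (pval V') (dsubmx V) = dsubmx W.
    by rewrite map_dsubmx [map_mx _ _]pmap_var col_mxKd.
  have -> : map_mx (pval V') (mxvec (map_mx lift_s (P j))) = (q j).@[s] *: mxvec Z.
    apply/rowP=> i; case/mxvec_indexP: i => i i'; rewrite !mxE !mxvecE !mxE.
    by rewrite [LHS]liftE ZE mxE mulrC divfK.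
  have -> : pval V' (lift_s (q j)) = (q j).@[s] by exact: liftE.
  rewrite -scalemxAl -scalerN -scale_col_mx; congr (_ *: _).
  rewrite -[RHS]vsubmxK; congr col_mx; apply/eqP; rewrite eq_sym -addr_eq0.
  by move/eqP: WZ; rewrite -[W in _ *m W]vsubmxK mul_row_col mul1mx.
case/mxvec_indexP: k => i l; rewrite !mxvecE.
have /matrixP/(_ i l) := coefsE; rewrite !mxE [pval _ _]/pval => ->.
by rewrite mulrAC mulfV // mul1r.
Qed.

End Dimension.

Lemma leq_pow2r a b e : (a <= b)%N -> (a ^ e <= b ^ e)%N.
Proof. by case: e => // e; rewrite leq_exp2r. Qed.

(** Where the leading coefficient of the common equation of the coordinates does
  not vanish at W, each coordinate takes fewer values than the size of that
  equation. *)
Lemma finite_slice (F : closedFieldType) m n (X : set 'M[F]_(m, n)) d :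
  rational_cover X d -> exists B : nat,
  generically [set: 'M[F]_(1 + m * n, d)] (fun W =>
    forall c (z : 'I_c -> 'M[F]_(m, n)), injective z ->
      (forall i, (X `&` slice W) (z i)) -> (c <= B)%N).
Proof.
move=> /rational_cover_slice[h h0 hP]; exists (size h ^ (m * n))%N.
apply/genericallyP; exists (lead_coef h); first by rewrite lead_coef_eq0.
move=> W hW c z z_inj zX.
have hW0 : map_poly (pval W) h != 0.
  apply: contra_neq hW => /(congr1 (fun q : {poly F} => q`_(size h).-1)).
  by rewrite coef_map coef0.
pose rs := undup [seq z i ab.1 ab.2 | i <- enum 'I_c, ab <- enum {: 'I_m * 'I_n}].
have rs_small : (size rs < size h)%N.
  apply: leq_trans (size_poly _ _ : size (map_poly (pval W) h) <= _)%N.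
  apply: max_poly_roots => //; last exact: undup_uniq.
  apply/allP => x; rewrite mem_undup => /allpairsP[[i ab] [_ _ ->]].
  by have [? ?] := zX i; apply: hP.
have zrs i a b : z i a b \in rs.
  by rewrite mem_undup; apply/allpairsP; exists (i, (a, b)); rewrite !mem_enum.
pose t (i : 'I_c) : {ffun 'I_m * 'I_n -> seq_sub rs} := [ffun ab => SeqSub (zrs i ab.1 ab.2)].
have t_inj : injective t.
  move=> i i' /ffunP tt; apply/z_inj/matrixP=> a b.
  by have := tt (a, b); rewrite !ffunE => /(congr1 val).
have := leq_card _ t_inj; rewrite card_ffun card_prod !card_ord card_seq_sub ?undup_uniq //.
by move/leq_trans; apply; apply: leq_pow2r; apply: ltnW.
Qed.

(** * Definable sets over an algebraically closed field *)

Section Definable.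
Variable F : closedFieldType.

(** Solution sets of first-order formulas without inversion; the environment is
  seen as a function on nat, zero outside of a finite range. *)
Definition definable (P : (nat -> F) -> Prop) :=
  exists2 f, GRing.rformula f & forall e : seq F, GRing.holds e f <-> P (nth 0 e).

Definition term_definable (g : (nat -> F) -> F) :=
  exists2 t, GRing.rterm t & forall e : seq F, GRing.eval e t = g (nth 0 e).

Lemma term_definable_var j : term_definable (fun e => e j).
Proof. by exists (GRing.Var _ j). Qed.

Lemma term_definable_const a : term_definable (fun=> a).
Proof. by exists (GRing.Const a). Qed.

Lemma term_definableM g h : term_definable g -> term_definable h ->
  term_definable (fun e => g e * h e).
Proof.
by move=> [t rt tE] [u ru uE]; exists (GRing.Mul t u) => [|e] /=; rewrite ?rt ?tE ?uE.
Qed.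

Lemma term_definableX g k : term_definable g -> term_definable (fun e => g e ^+ k).
Proof. by move=> [t rt tE]; exists (GRing.Exp t k) => [|e] //=; rewrite tE. Qed.

Lemma term_definable_sum (I : Type) (s : seq I) (g : I -> (nat -> F) -> F) :
  (forall i, term_definable (g i)) -> term_definable (fun e => \sum_(i <- s) g i e).
Proof.
move=> gP; elim: s => [|i s [t rt tE]].
  by exists (GRing.Const 0) => // e; rewrite big_nil.
have [u ru uE] := gP i.
by exists (GRing.Add u t) => [|e] /=; rewrite ?ru // big_cons uE tE.
Qed.

Lemma term_definable_prod (I : Type) (s : seq I) (g : I -> (nat -> F) -> F) :
  (forall i, term_definable (g i)) -> term_definable (fun e => \prod_(i <- s) g i e).
Proof.
move=> gP; elim: s => [|i s [t rt tE]].
  by exists (GRing.Const 1) => // e; rewrite big_nil.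
have [u ru uE] := gP i.
by exists (GRing.Mul u t) => [|e] /=; rewrite ?ru // big_cons uE tE.
Qed.

Lemma term_definable_pval m n (Z : (nat -> F) -> 'M[F]_(m, n)) p :
  (forall a b, term_definable (fun e => Z e a b)) ->
  term_definable (fun e => pval (Z e) p).
Proof.
move=> ZP; apply: term_definable_sum => mo.
apply: term_definableM; first exact: term_definable_const.
apply: term_definable_prod => i; apply: term_definableX.
case/mxvec_indexP: i => a b; have [t rt tE] := ZP a b.
by exists t => // e; rewrite mxvecE.
Qed.

Lemma definable_eq g h : term_definable g -> term_definable h ->
  definable (fun e => g e = h e).
Proof.
by move=> [t rt tE] [u ru uE]; exists (GRing.Equal t u) => [|e] /=; rewrite ?rt ?tE ?uE.
Qed.

Lemma definable_not P : definable P -> definable (fun e => ~ P e).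
Proof. by move=> [f rf fE]; exists (GRing.Not f) => //= e; rewrite fE. Qed.

Lemma definable_and P Q : definable P -> definable Q -> definable (fun e => P e /\ Q e).
Proof.
by move=> [f rf fE] [g rg gE]; exists (GRing.And f g) => [|e] /=; rewrite ?rf ?fE ?gE.
Qed.

Lemma definable_true : definable (fun=> True).
Proof. by exists (GRing.Bool true). Qed.

Lemma definable_imply (b : bool) P : (b -> definable P) -> definable (fun e => b -> P e).
Proof.
case: b => [/(_ isT)[f rf fE]|_]; first by exists f => // e; rewrite fE; split=> [//|]; apply.
by have [f rf fE] := definable_true; exists f => // e; rewrite fE; split.
Qed.

Lemma definable_all (I : finType) (P : I -> (nat -> F) -> Prop) :
  (forall i, definable (P i)) -> definable (fun e => forall i, P i e).
Proof.
move=> PP; suff [f rf fE] : definable (fun e => forall i, i \in enum I -> P i e).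
  by exists f => // e; rewrite fE; split=> Pe i; [apply: Pe; rewrite mem_enum|move=> _].
elim: (enum I) => [|i s IHs].
  by have [f rf fE] := definable_true; exists f => // e; rewrite fE; split.
have [f rf fE] := definable_and (PP i) IHs.
exists f => // e; rewrite fE; split=> [[Pi Ps] j|Ps].
  by rewrite inE => /predU1P[->|/Ps].
by split=> [|j js]; apply: Ps; rewrite inE ?eqxx ?js ?orbT.
Qed.

(** Quantification over the block of variables I at once. *)
Lemma definable_ex (I : seq nat) P : definable P ->
  definable (fun e => exists e' : seq F, (forall j, j \notin I -> e j = e'`_j) /\ P (nth 0 e')).
Proof.
move=> [f rf fE]; exists (foldr GRing.Exists f I) => [|e]; first by elim: I.
rewrite -GRing.foldExistsP; split=> [[e' ee' /fE Pe']|[e' [ee' Pe']]].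
  by exists e'; split.
by exists e'; [|apply/fE].
Qed.

Definition row_env n (v : 'rV[F]_n) : seq F := [seq v 0 i | i <- enum 'I_n].

Lemma nth_row_env n (v : 'rV[F]_n) (i : 'I_n) : (row_env v)`_i = v 0 i.
Proof. by rewrite (nth_map i) ?size_enum_ord // nth_ord_enum. Qed.

Lemma nth_row_env_out n (v : 'rV[F]_n) i : (n <= i)%N -> (row_env v)`_i = 0.
Proof. by move=> ni; rewrite nth_default // size_map size_enum_ord. Qed.

Lemma eval_pval m n (t : GRing.term F) : GRing.rterm t ->
  exists p, forall W : 'M[F]_(m, n), GRing.eval (row_env (mxvec W)) t = pval W p.
Proof.
elim: t => //=.
- move=> i _; have [im|mi] := ltnP i (m * n).
    by exists 'X_(Ordinal im) => W; rewrite [RHS]mevalXU -nth_row_env.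
  by exists 0 => W; rewrite nth_row_env_out // raddf0.
- by move=> x _; exists x%:MP => W; rewrite /pval mevalC.
- by move=> k _; exists k%:R => W; rewrite rmorph_nat.
- move=> t1 IH1 t2 IH2 /andP[/IH1[p pE] /IH2[q qE]].
  by exists (p + q) => W; rewrite rmorphD /= pE qE.
- by move=> t IH /IH[p pE]; exists (- p) => W; rewrite rmorphN /= pE.
- by move=> t IH k /IH[p pE]; exists (p *+ k) => W; rewrite rmorphMn /= pE.
- move=> t1 IH1 t2 IH2 /andP[/IH1[p pE] /IH2[q qE]].
  by exists (p * q) => W; rewrite rmorphM /= pE qE.
- by move=> t IH k /IH[p pE]; exists (p ^+ k) => W; rewrite rmorphXn /= pE.
Qed.

(** An equation either holds identically or fails on a nonempty open set; Boolean
  combinations inherit this dichotomy. *)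
Lemma generic_qf m n (f : GRing.formula F) : GRing.qf_form f -> GRing.rformula f ->
  exists b, generically [set: 'M[F]_(m, n)]
    (fun W => GRing.qf_eval (row_env (mxvec W)) f = b).
Proof.
elim: f => //=.
- move=> b _ _; exists b; apply/genericallyP; exists 1; rewrite ?oner_eq0 //.
- move=> t1 t2 _ /andP[/(eval_pval m n)[p pE] /(eval_pval m n)[q qE]].
  have [pq|pq] := eqVneq p q.
    by exists true; apply/genericallyP; exists 1 => [|W _]; rewrite ?oner_eq0 // pE qE pq eqxx.
  exists false; apply/genericallyP; exists (p - q); first by rewrite subr_eq0.
  by move=> W; rewrite rmorphB /= subr_eq0 pE qE => /negbTE.
- move=> f IHf g IHg /andP[qf qg] /andP[rf rg].
  have [b fb] := IHf qf rf; have [c gc] := IHg qg rg; exists (b && c).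
  by apply: generically_sub (generically_and fb gc) => W [-> ->].
- move=> f IHf g IHg /andP[qf qg] /andP[rf rg].
  have [b fb] := IHf qf rf; have [c gc] := IHg qg rg; exists (b || c).
  by apply: generically_sub (generically_and fb gc) => W [-> ->].
- move=> f IHf g IHg /andP[qf qg] /andP[rf rg].
  have [b fb] := IHf qf rf; have [c gc] := IHg qg rg; exists (b ==> c).
  by apply: generically_sub (generically_and fb gc) => W [-> ->].
- move=> f IHf qf rf; have [b fb] := IHf qf rf; exists (~~ b).
  by apply: generically_sub fb => W ->.
Qed.

(** Quantifier elimination reduces this to quantifier-free formulas. *)
Lemma generic_definable m n P : definable P ->
  generically [set: 'M[F]_(m, n)] (fun W => P (nth 0 (row_env (mxvec W)))) \/
  generically [set: 'M[F]_(m, n)] (fun W => ~ P (nth 0 (row_env (mxvec W)))).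
Proof.
move=> [f rf fE].
have F_closed : GRing.closed_field_axiom F by exact: solve_monicpoly.
pose wf := @ClosedFieldQE.wf_ex_elim F.
pose ok := ClosedFieldQE.holds_ex_elim F_closed.
have /andP[qq rq] := GRing.quantifier_elim_wf wf rf.
have [b bP] := generic_qf m n qq rq.
case: b bP => bP; [left|right]; apply: generically_sub bP => W.
  by move/(GRing.quantifier_elim_rformP wf ok _ rf)/fE.
by move=> /negbT/(GRing.quantifier_elim_rformP wf ok _ rf) nf /fE.
Qed.

End Definable.

(** * Counting the points of a generic slice *)

Definition has_points (T : Type) (X : set T) c :=
  exists z : 'I_c -> T, injective z /\ forall i, X (z i).

Lemma has_pointsP (T : Type) (X : set T) c : has_points X c <-> (`I_c #<= X)%card.
Proof.
rewrite (card_le_eql (@card_II c)); split=> [[z [z_inj zX]]|/card_leP[f]].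
  apply: card_le_trans (subset_card_le _ : (z @` [set: 'I_c] #<= X)%card); last first.
    by move=> _ [i _ <-].
  have zT : (z @` [set: 'I_c] #= [set: 'I_c])%card.
    by apply: inj_card_eq => i j _ _; apply: z_inj.
  by rewrite (card_le_eqr zT) card_lexx.
exists (fun i => val (f (to_setT i))); split=> [i j /val_inj fij|i].
  by have /(congr1 val) := 'inj_f (in_setT _) (in_setT _) fij.
exact: set_valP.
Qed.

Lemma has_points_card (T : Type) (X : set T) c :
  has_points X c -> ~ has_points X c.+1 -> (X #= `I_c)%card.
Proof.
move=> /has_pointsP Xc nXc; have [k Xk] : finite_set X.
  apply: contrapT => /infiniteP Xinf; apply/nXc/has_pointsP.
  by apply: card_le_trans Xinf; apply: subset_card_le.
move: Xc; rewrite (card_le_eqr Xk) card_le_II => ck.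
suff -> : c = k by [].
apply/eqP; rewrite eqn_leq ck leqNgt; apply/negP => kc; apply/nXc/has_pointsP.
by rewrite (card_le_eqr Xk) card_le_II.
Qed.

(** A point outside of the range of c distinct points of X would give c + 1
  distinct points. *)
Lemma card_enumeration (T : Type) (X : set T) c : (X #= `I_c)%card ->
  exists2 z : 'I_c -> T, injective z & X = range z.
Proof.
move=> Xc; have /has_pointsP[z [z_inj zX]] : (`I_c #<= X)%card by rewrite (card_le_eqr Xc).
exists z => //; apply/seteqP; split=> [x Xx|_ [i _ <-] //].
apply: contrapT => nx; have : has_points X c.+1; last first.
  by move/has_pointsP; rewrite (card_le_eqr Xc) card_le_II ltnn.
exists (fun i => if unlift ord_max i is Some j then z j else x); split=> [i j|i].
  case: unliftP => [i' ->|->]; case: unliftP => [j' ->|->] //= e.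
  - by rewrite (z_inj _ _ e).
  - by case: nx; exists i'.
  - by case: nx; exists j'.
by case: unliftP => [i' _|_].
Qed.

Lemma card_setT_finType (T : finType) : ([set: T] #= `I_#|T|)%card.
Proof.
rewrite (card_eqr card_II).
have <- : @enum_rank T @` [set: T] = [set: 'I_#|T|].
  by apply/seteqP; split=> i _ //; exists (enum_val i); rewrite ?enum_valK.
by rewrite card_eq_sym; apply: inj_card_eq => i j _ _; apply: enum_rank_inj.
Qed.

Lemma card_bigcup_disjoint (T : Type) (J : finType) (X : J -> set T) c :
  (forall i, X i #= `I_c)%card -> (forall i j, X i `&` X j !=set0 -> i = j) ->
  (\bigcup_i X i #= `I_(c * #|J|))%card.
Proof.
move=> Xc Xdis.
have /choice[z zP] (i : J) : exists z : 'I_c -> T, injective z /\ X i = range z.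
  by have [z] := card_enumeration (Xc i); exists z.
have -> : (c * #|J|)%N = #|{: J * 'I_c}| by rewrite card_prod card_ord mulnC.
rewrite -(card_eqr (card_setT_finType _)).
have -> : \bigcup_i X i = (fun ij => z ij.1 ij.2) @` [set: J * 'I_c].
  apply/seteqP; split=> [x [i _]|_ [[i j] _ <-]].
    by have [_ ->] := zP i => -[j _ <-]; exists (i, j).
  by exists i => //; have [_ ->] := zP i; exists j.
apply: inj_card_eq => -[i j] [i' j'] _ _ /= e.
have ii' : i = i'.
  apply: Xdis; exists (z i j); split; first by have [_ ->] := zP i; exists j.
  by have [_ ->] := zP i'; exists j'.
by rewrite -ii' in e *; have [z_inj _] := zP i; rewrite (z_inj _ _ e).
Qed.

Section Counting.
Variable F : closedFieldType.

(** Having c distinct points on the slice is a first-order property of the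
  coefficients W: the points form a block of c m n quantified variables, placed
  after the variables of W. *)
Lemma generic_has_points m n d p q (f : 'M[{mpoly F[m * n]}]_(p, q)) c :
  let X := [set Z | pmap_mx f Z = 0] in
  generically [set: 'M[F]_(1 + m * n, d)] (fun W => has_points (X `&` slice W) c) \/
  generically [set: 'M[F]_(1 + m * n, d)] (fun W => ~ has_points (X `&` slice W) c).
Proof.
move=> X; pose M := ((1 + m * n) * d)%N; pose N := (c * (m * n))%N.
pose Wof (e : nat -> F) : 'M[F]_(1 + m * n, d) :=
  \matrix_(a, b) e (lshift N (mxvec_index a b) : 'I_(M + N)).
pose Zof (e : nat -> F) i : 'M[F]_(m, n) :=
  \matrix_(a, b) e (rshift M (mxvec_index i (mxvec_index a b)) : 'I_(M + N)).
(* The environment lists the entries of W, then those of the c points. *)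
pose body e := (forall i, X (Zof e i)) /\ ((forall i, slice (Wof e) (Zof e i)) /\
  (forall ij : 'I_c * 'I_c, ij.1 != ij.2 -> Zof e ij.1 <> Zof e ij.2)).
have Wd a b : term_definable (fun e => Wof e a b).
  have [t rt tE] := term_definable_var F (lshift N (mxvec_index a b) : 'I_(M + N)).
  by exists t => // e; rewrite mxE.
have Zd i a b : term_definable (fun e => Zof e i a b).
  have [t rt tE] := term_definable_var F
    (rshift M (mxvec_index i (mxvec_index a b)) : 'I_(M + N)).
  by exists t => // e; rewrite mxE.
have eq_mx r s (A B : (nat -> F) -> 'M[F]_(r, s)) :
    (forall a b, term_definable (fun e => A e a b)) ->
    (forall a b, term_definable (fun e => B e a b)) -> definable (fun e => A e = B e).
  move=> Ad Bd; have [g rg gE] : definable (fun e => forall ab, A e ab.1 ab.2 = B e ab.1 ab.2).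
    by apply: definable_all => ab; apply: definable_eq.
  exists g => // e; rewrite gE; split=> [AB|-> //].
  by apply/matrixP=> a b; apply: (AB (a, b)).
have body_def : definable body.
  apply: definable_and; [|apply: definable_and].
  - apply: definable_all => i; apply: eq_mx => a b; last first.
      by have [t rt tE] := term_definable_const (0 : F); exists t => // e; rewrite tE mxE.
    have [t rt tE] := term_definable_pval (f a b) (Zd i).
    by exists t => // e; rewrite tE mxE.
  - apply: definable_all => i; apply: eq_mx => a b; last first.
      by have [t rt tE] := term_definable_const (0 : F); exists t => // e; rewrite tE mxE.
    have [t rt tE] : term_definable (fun e =>
        \sum_k (row_mx 1%:M (mxvec (Zof e i)) : 'rV_(1 + m * n)) a k * Wof e k b).
      apply: term_definable_sum => k; apply: term_definableM (Wd k b).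
      case: (splitP k) => k' kk'.
        have [t rt tE] := term_definable_const ((1%:M : 'M[F]_1) a k').
        exists t => // e; rewrite tE; have -> : k = lshift _ k' by apply/val_inj.
        by rewrite row_mxEl.
      case/mxvec_indexP: k' kk' => r s kk'.
      have [t rt tE] := Zd i r s; exists t => // e; rewrite tE.
      have -> : k = rshift 1 (mxvec_index r s) by apply/val_inj.
      by rewrite row_mxEr (ord1 a) mxvecE.
    by exists t => // e; rewrite tE mxE.
  - apply: definable_all => ij; apply: definable_imply => _.
    by apply/definable_not/eq_mx.
pose block := [seq (rshift M i : 'I_(M + N)) : nat | i <- enum 'I_N].
have blockP j : (j \in block) = (M <= j < M + N)%N.
  apply/mapP/andP => [[i _ ->]|[Mj jN]]; first by rewrite leq_addr ltn_ord.
  have jN' : (j - M < N)%N by rewrite ltn_subLR.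
  by exists (Ordinal jN'); rewrite ?mem_enum //= subnKC.
suff PE (W : 'M_(1 + m * n, d)) : has_points (X `&` slice W) c <->
    exists e' : seq F, (forall j, j \notin block -> (row_env (mxvec W))`_j = e'`_j) /\
      body (nth 0 e').
  have [] := generic_definable (1 + m * n) d (definable_ex block body_def) => gP;
    [left|right]; apply: generically_sub gP => W.
    by rewrite PE.
  by rewrite PE.
split=> [[z [z_inj zX]]|[e' [e'W [eX [eW e_inj]]]]].
  pose zz := \matrix_i mxvec (z i).
  exists (row_env (row_mx (mxvec W) (mxvec zz))); split=> [j|].
    rewrite blockP negb_and -!ltnNge => /orP[jM|].
      have -> : j = (lshift N (Ordinal jM) : 'I_(M + N)) by [].
      by rewrite [RHS]nth_row_env row_mxEl -nth_row_env.
    by rewrite ltnS => Nj; rewrite !nth_row_env_out // (leq_trans _ Nj) ?leq_addr.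
  have We : Wof (nth 0 (row_env (row_mx (mxvec W) (mxvec zz)))) = W.
    by apply/matrixP=> a b; rewrite mxE nth_row_env row_mxEl mxvecE.
  have Ze i : Zof (nth 0 (row_env (row_mx (mxvec W) (mxvec zz)))) i = z i.
    by apply/matrixP=> a b; rewrite mxE nth_row_env row_mxEr mxvecE mxE mxvecE.
  split=> [i|]; first by rewrite Ze; have [] := zX i.
  split=> [i|[i j] /= ij]; first by rewrite Ze We; have [] := zX i.
  by rewrite !Ze => /z_inj/eqP; apply/negP.
exists (Zof (nth 0 e')); split=> [i j zij|i].
  by have [//|ij] := eqVneq i j; have := e_inj (i, j) ij.
split; first exact: eX.
suff -> : W = Wof (nth 0 e') by apply: eW.
apply/matrixP=> a b; rewrite mxE -mxvecE -nth_row_env; apply: e'W.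
by rewrite blockP negb_and -ltnNge ltn_ord.
Qed.

(** The number of points of a generic slice is the largest c such that having c
  points is generic; it exists since the number of points is generically bounded. *)
Lemma has_degree_exists m n d p q (f : 'M[{mpoly F[m * n]}]_(p, q)) :
  let X := [set Z | pmap_mx f Z = 0] in
  rational_cover X d -> has_dim X d -> exists e, has_degree X e.
Proof.
move=> X Xd dimX; have [B BP] := finite_slice Xd.
pose G c := generically [set: 'M[F]_(1 + m * n, d)] (fun W => has_points (X `&` slice W) c).
have G0 : G 0%N.
  apply/genericallyP; exists 1; rewrite ?oner_eq0 // => W _.
  by exists (fun=> 0); split=> [] [].
have GB : ~ G B.+1.
  move=> GB; have /genericallyP[r r0 rP] := generically_and BP GB.
  have [v rv] := mpoly_nonroot r0; rewrite -pval_vec_mx in rv.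
  have [WB [z [z_inj zX]]] := rP _ rv.
  by have := WB _ z z_inj zX; rewrite ltnn.
have [e Ge Ge1] : exists2 e, G e & ~ G e.+1.
  apply: contrapT => no; apply: GB; elim: {Xd dimX BP} B.+1 => // c Gc.
  by apply: contrapT => nGc; apply: no; exists c.
exists e; exists d; split=> //.
have [//|] := generic_has_points d f e.+1 => nGe.
apply: generically_sub (generically_and Ge nGe) => W [We Wn].
exact: has_points_card.
Qed.

End Counting.

(** * Linear images, closures and rational families *)

Section LinearImage.
Variable F : fieldType.
Variables (p m n : nat) (A : 'M[F]_(p, m)).

Notation image := (fun X : set 'M[F]_(m, n) => [set A *m Z | Z in X]).

(** The image is cut out by Z = A B Z and the pulled back equations of X at B Z. *)
Lemma zclosed_image (B : 'M[F]_(m, p)) X :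
  B *m A = 1%:M -> zclosed X -> zclosed (image X).
Proof.
move=> BA Xc; have -> : image X = [set Z | X (B *m Z)] `&` [set Z | A *m B *m Z = Z].
  apply/seteqP; split=> Z /=.
    move=> [Y XY <-]; rewrite mulmxA BA mul1mx; split=> //.
    by rewrite -mulmxA (mulmxA B) BA mul1mx.
  by move=> [XBZ ABZ]; exists (B *m Z); rewrite // mulmxA.
apply: zclosedI; first exact: zclosed_mul_preim.
have := zclosed_polys (mul_var n (A *m B) - var_mx F p n).
congr zclosed; apply/seteqP; split=> Z /=; rewrite pmap_mxB pmap_mul_var pmap_var.
  by move/eqP; rewrite subr_eq0 => /eqP.
by move->; rewrite subrr.
Qed.

Lemma zirreducible_image X : zirreducible X -> zirreducible (image X).
Proof.
move=> [[Z XZ] Xirr]; split; first by exists (A *m Z), Z.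
move=> Y1 Y2 /(zclosed_mul_preim A) Y1c /(zclosed_mul_preim A) Y2c XY.
have [|XY1|XY2] := Xirr _ _ Y1c Y2c.
- by move=> Z' XZ'; apply: XY; exists Z'.
- by left=> _ [Z' XZ' <-]; apply: XY1.
- by right=> _ [Z' XZ' <-]; apply: XY2.
Qed.

Lemma zchain_image (B : 'M[F]_(m, p)) X d :
  B *m A = 1%:M -> zchain X d -> zchain (image X) d.
Proof.
move=> BA [Y [Yirr Ylt]]; exists (fun i => image (Y i)).
split=> [i /Yirr[Yc Yi YX]|i /Ylt[Ysub Ynsub]].
  split; [exact: zclosed_image BA Yc|exact: zirreducible_image|].
  by move=> _ [Z YZ <-]; exists Z => //; apply: YX.
split=> [_ [Z YZ <-]|YY]; first by exists Z => //; apply: Ysub.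
apply: Ynsub => Z YZ; have [|Z' YZ' AZ] := YY (A *m Z); first by exists Z.
by rewrite -[Z]mul1mx -BA -mulmxA -AZ mulmxA BA mul1mx.
Qed.

Lemma rational_map_mulC d (P : 'M[{mpoly F[d]}]_(m, n)) q s :
  rational_map (map_mx (@mpolyC d F) A *m P) q s = A *m rational_map P q s.
Proof.
apply/matrixP=> a b; rewrite !mxE raddf_sum mulr_suml; apply: eq_bigr => c _.
by rewrite !mxE /= mevalM mevalC mulrA.
Qed.

Lemma rational_cover_image X d : rational_cover X d -> rational_cover (image X) d.
Proof.
move=> [J [P [q XPq]]]; exists J, (fun j => map_mx (@mpolyC d F) A *m P j), q.
move=> _ [Z /XPq[j [s [qs ->]]] <-]; by exists j, s; rewrite rational_map_mulC.
Qed.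

End LinearImage.

Section Closure.

(** The charts of the union are the disjoint sum of the charts of the sets. *)
Lemma rational_cover_bigcup (F : fieldType) m n (I : finType) (D : set I)
    (X : I -> set 'M[F]_(m, n)) d :
  (forall i, D i -> rational_cover (X i) d) ->
  rational_cover (\bigcup_(i in D) X i) d.
Proof.
move=> Xd.
pose D' := {i : I | `[< D i >]}.
pose atlas := {J : finType & ((J -> 'M[{mpoly F[d]}]_(m, n)) * (J -> {mpoly F[d]}))%type}.
have /choice[a aP] (i : D') : exists a : atlas, forall Z, X (val i) Z ->
    exists (j : projT1 a) s, ((projT2 a).2 j).@[s] != 0 /\
      Z = rational_map ((projT2 a).1 j) ((projT2 a).2 j) s.
  case: i => i /= /asboolP/Xd[J [P [q XPq]]].
  by exists (existT _ J (P, q)).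
exists {i : D' & projT1 (a i)}, (fun ij => (projT2 (a (tag ij))).1 (tagged ij)),
  (fun ij => (projT2 (a (tag ij))).2 (tagged ij)).
move=> Z [i /asboolP Di /(aP (Sub i Di))[j jP]].
by exists (Tagged (fun i => projT1 (a i)) j).
Qed.

Variable F : closedFieldType.

Definition zclosure m n (X : set 'M[F]_(m, n)) : set 'M[F]_(m, n) :=
  [set Z | forall p, (forall Y, X Y -> pval Y p = 0) -> pval Z p = 0].

Lemma zclosed_zclosure m n (X : set 'M[F]_(m, n)) : zclosed (zclosure X).
Proof. by exists [set p | forall Y, X Y -> pval Y p = 0]. Qed.

Lemma sub_zclosure m n (X : set 'M[F]_(m, n)) : X `<=` zclosure X.
Proof. by move=> Z XZ p; apply. Qed.

Lemma zclosure_min m n (X Y : set 'M[F]_(m, n)) :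
  zclosed Y -> X `<=` Y -> zclosure X `<=` Y.
Proof.
move=> [S ->] XS Z ZX p pS; apply: ZX => Z' /XS; exact.
Qed.

(** If neither closed set contains the image, some polynomial vanishing on each
  of them is nonzero at some parameter; on the line between the two parameters
  there is one at which both polynomials and the denominator are nonzero. *)
Lemma zirreducible_rational d m n (P : 'M[{mpoly F[d]}]_(m, n)) q
    (L : set ('I_d -> F)) :
    (forall v w t, L v -> L w -> L (fun i => v i + t * (w i - v i))) ->
    (exists2 s, L s & q.@[s] != 0) ->
  zirreducible (zclosure [set rational_map P q s | s in [set s | L s /\ q.@[s] != 0]]).
Proof.
move=> L_line [s0 Ls0 qs0]; set X := [set _ | _ in _]; split.
  by exists (rational_map P q s0); apply: sub_zclosure; exists s0.
move=> Y1 Y2 Y1c Y2c XY; apply: contrapT => /not_orP[nY1 nY2].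
have sep (Y : set 'M[F]_(m, n)) : zclosed Y -> ~ (zclosure X `<=` Y) ->
    exists p' : {mpoly F[d]}, (exists2 s, L s & (q * p').@[s] != 0) /\
      forall s, Y (rational_map P q s) -> q.@[s] != 0 -> p'.@[s] = 0.
  move=> Yc nY; have [Z XZ nYZ] : exists2 Z, X Z & ~ Y Z.
    apply: contrapT => no; apply: nY; apply: zclosure_min => // Z XZ.
    by apply: contrapT => nYZ; apply: no; exists Z.
  have [S YS] := Yc; move: nYZ; rewrite YS => /existsNP[p /not_implyP[pS /eqP Zp]].
  have [p' p'E] := rational_comp (fun k => mxvec P 0 k) q (leqnn (msize p)).
  have pE s : q.@[s] != 0 -> pval (rational_map P q s) p = p'.@[s] / (q ^+ msize p).@[s].
    move=> /p'E <-; apply: meval_eq => k.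
    by case/mxvec_indexP: k => a b; rewrite !mxvecE mxE.
  exists p'; split.
    case: XZ Zp => s [Ls qs] <-; rewrite pE // mulf_eq0 negb_or => /andP[p's _].
    by exists s => //; rewrite mevalM mulf_neq0.
  move=> s + qs => /(_ p pS); move: (pE s qs) => -> /eqP.
  by rewrite mulf_eq0 invr_eq0 rmorphXn /= expf_eq0 (negbTE qs) andbF orbF => /eqP.
have [p1 [[s1 Ls1 ps1] p1E]] := sep _ Y1c nY1.
have [p2 [[s2 Ls2 ps2] p2E]] := sep _ Y2c nY2.
have [t []] := common_nonroot ps1 ps2; set s := (fun i => _).
rewrite !mevalM !mulf_eq0 !negb_or => /andP[qs p1s] /andP[_ p2s].
have [||] := XY (rational_map P q s).
- by apply: sub_zclosure; exists s => //; split=> //; apply: L_line.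
- by move=> /p1E/(_ qs)/eqP; apply/negP.
- by move=> /p2E/(_ qs)/eqP; apply/negP.
Qed.

End Closure.

(** * The Cayley transform *)

Definition upper_pair k := {ij : 'I_k * 'I_k | (ij.1 < ij.2)%N}.

Lemma card_upper_pair k : #|{: upper_pair k}| = 'C(k, 2).
Proof.
rewrite card_sig -sum1_card.
rewrite (eq_bigl (fun ij : 'I_k * 'I_k => true && (ij.1 < ij.2)%N)) //.
rewrite -(pair_big_dep xpredT (fun i j : 'I_k => (i < j)%N) (fun _ _ => 1%N)) /=.
rewrite (exchange_big_dep xpredT) //= -bin2_sum big_mkord; apply: eq_bigr => j _.
rewrite -(big_ord_widen k (fun=> 1%N) (ltnW (ltn_ord j))).
by rewrite sum1_card card_ord.
Qed.

Definition skew_of (R : pzRingType) k (s : 'I_#|{: upper_pair k}| -> R) : 'M[R]_k :=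
  \matrix_(i, j)
    if insub (i, j) is Some t then s (enum_rank t)
    else if insub (j, i) is Some t then - s (enum_rank t) else 0.

Lemma skew_of_trmx (R : pzRingType) k (s : 'I_#|{: upper_pair k}| -> R) :
  (skew_of s)^T = - skew_of s.
Proof.
apply/matrixP=> i j; rewrite !mxE.
case: insubP => [t /= ji _|_]; last by case: insubP => [t _ _|_]; rewrite ?opprK ?oppr0.
by rewrite insubN ?opprK //= -leqNgt ltnW.
Qed.

Lemma map_skew_of (R S : pzRingType) (f : {rmorphism R -> S}) k
    (s : 'I_#|{: upper_pair k}| -> R) :
  map_mx f (skew_of s) = skew_of (f \o s).
Proof.
apply/matrixP=> i j; rewrite !mxE.
by case: insub => [t|] //; case: insub => [t|]; rewrite ?rmorphN ?rmorph0.
Qed.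

Lemma skew_of_upper (R : pzRingType) k (s : 'I_#|{: upper_pair k}| -> R) t :
  skew_of s (val (enum_val t)).1 (val (enum_val t)).2 = s t.
Proof. by rewrite mxE -surjective_pairing valK enum_valK. Qed.

Section Cayley.
Variable F : fieldType.
Hypothesis F2 : (2 : F) != 0.
Variable k : nat.
Implicit Types S Q : 'M[F]_k.

Lemma skew_ofP S : S^T = - S ->
  S = skew_of (fun t => S (val (enum_val t)).1 (val (enum_val t)).2).
Proof.
move=> /matrixP ST; apply/matrixP=> i j; rewrite !mxE.
case: insubP => [t _ tE|]; first by rewrite enum_rankK tE.
rewrite /= -leqNgt => ji.
have ST' : S j i = - S i j by have := ST i j; rewrite !mxE.
case: insubP => [t _ tE|]; first by rewrite enum_rankK tE ST' opprK.
rewrite /= -leqNgt => ij.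
have e : i = j by apply/val_inj/eqP; rewrite /= eqn_leq ij ji.
move: ST'; rewrite e => /eqP; rewrite -addr_eq0 -mulr2n -mulr_natl mulf_eq0 (negbTE F2).
by move/eqP.
Qed.

Definition cayley S := (1%:M - S) *m invmx (1%:M + S).

Lemma cayley_mul S : 1%:M + S \in unitmx -> cayley S *m (1%:M + S) = 1%:M - S.
Proof. by move=> uS; rewrite mulmxKV. Qed.

Lemma trmx1D S : (1%:M + S)^T = 1%:M + S^T.
Proof. by rewrite linearD /= trmx1. Qed.

Lemma trmx1B S : (1%:M - S)^T = 1%:M - S^T.
Proof. by rewrite linearB /= trmx1. Qed.

Lemma comm_1BD S : (1%:M - S) *m (1%:M + S) = (1%:M + S) *m (1%:M - S).
Proof.
by rewrite [LHS]mulmxDr [RHS]mulmxDl mulmx1 mul1mx mulmxBl mulmxBr mul1mx mulmx1.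
Qed.

Lemma add1_cayley S : 1%:M + S \in unitmx ->
  (1%:M + cayley S) *m (1%:M + S) = 2%:M.
Proof.
move=> uS; rewrite mulmxDl cayley_mul // mul1mx.
by rewrite addrACA subrr addr0 -raddfD.
Qed.

Lemma unitmx_add1_cayley S : 1%:M + S \in unitmx -> 1%:M + cayley S \in unitmx.
Proof.
move=> uS; have := add1_cayley uS; move/(congr1 determinant).
rewrite det_mulmx det_scalar unitmxE unitfE => e.
by apply: contraNneq (expf_neq0 k F2) => c0; rewrite -e c0 mul0r.
Qed.

(** From (1 + cayley S)(1 + S) = 2 and (1 - cayley S)(1 + S) = 2 S. *)
Lemma cayleyK S : 1%:M + S \in unitmx -> cayley (cayley S) = S.
Proof.
move=> uS; have uC := unitmx_add1_cayley uS.
apply: (can_inj (mulmxK uC)); rewrite cayley_mul //.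
apply: (can_inj (mulmxK uS)); rewrite -mulmxA add1_cayley // mulmxBl cayley_mul // mul1mx.
by rewrite opprB addrC addrA subrK mul_mx_scalar scaler_nat mulr2n.
Qed.

(** Q = cayley S satisfies Q (1 + S) = 1 - S, and for S skew the matrices 1 + S
  and 1 - S are transposes of each other; they commute. *)
Lemma cayley_orthogonal S :
  S^T = - S -> 1%:M + S \in unitmx -> orthogonal_group F k (cayley S).
Proof.
move=> ST uS; rewrite /orthogonal_group /stiefel /=.
have uST : (1%:M + S)^T \in unitmx by rewrite unitmx_tr.
apply: (can_inj (mulKmx uST)); apply: (can_inj (mulmxK uS)).
have := cayley_mul uS; move: (cayley S) => Q QS.
rewrite -!mulmxA QS mulmxA -trmx_mul QS mul1mx.
by rewrite trmx1D trmx1B ST opprK comm_1BD.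
Qed.

(** With S = cayley Q, multiply by (1 + Q)^T on the left and by 1 + Q on the
  right: both sides become Q - Q^T. *)
Lemma cayley_skew Q : orthogonal_group F k Q -> 1%:M + Q \in unitmx ->
  (cayley Q)^T = - cayley Q.
Proof.
rewrite /orthogonal_group /stiefel /= => QQ uQ.
have uQT : (1%:M + Q)^T \in unitmx by rewrite unitmx_tr.
apply: (can_inj (mulKmx uQT)); apply: (can_inj (mulmxK uQ)).
have := cayley_mul uQ; move: (cayley Q) => S SQ.
rewrite -trmx_mul SQ -mulmxA mulNmx SQ.
rewrite trmx1D trmx1B mulmxDr mulmx1 mulmxBl mul1mx QQ mulmxN mulmxBr mulmx1 mulmxDl mul1mx QQ.
by rewrite opprB [LHS]addrC [LHS]addrA subrK opprD addrA addrK.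
Qed.

(** The determinant is affine in each diagonal sign, and its slope in the first
  one is the determinant of the remaining block, nonzero for good signs by
  induction: it cannot vanish at both signs. *)
Lemma det_add_signs m (M : 'M[F]_m) : exists b : 'I_m -> bool,
  \det (diag_mx (\row_i (-1) ^+ b i) + M) != 0.
Proof.
elim: m M => [|m IHm] M; first (exists (fun=> true); rewrite det_mx00; exact: oner_neq0).
have [b b0] := IHm (row' 0 (col' 0 M)).
(* The two candidates differ in the first sign only. *)
pose b' e (i : 'I_m.+1) : bool := if unlift 0 i is Some j then b j else e.
pose A e := diag_mx (\row_i (-1) ^+ b' e i) + M.
have [A1|A1] := eqVneq (\det (A true)) 0; last by exists (b' true).
have [A0|A0] := eqVneq (\det (A false)) 0; last by exists (b' false).
exfalso; move: A1 A0.
have A0E e : row' 0 (col' 0 (A e)) = diag_mx (\row_i (-1) ^+ b i) + row' 0 (col' 0 M).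
  by apply/matrixP=> i j; rewrite !mxE /b' liftK (inj_eq lift_inj).
have cofE j : cofactor (A true) 0 j = cofactor (A false) 0 j.
  congr (_ * \det _); apply/matrixP=> i l; rewrite !mxE.
  by have [e|] := eqVneq (lift 0 i) (lift j l); rewrite /b' ?mulr0n // liftK.
have : \det (A false) - \det (A true) = 2 * cofactor (A false) 0 0.
  rewrite !(expand_det_row _ 0) -sumrB (bigD1 0) //= big1 ?addr0 => [|j j0].
    rewrite cofE -mulrBl !mxE /b' unlift_none eqxx !mulr1n; congr (_ * _).
    by rewrite opprD addrACA subrr addr0 expr0 expr1 opprK.
  by rewrite cofE -mulrBl !mxE eq_sym (negbTE j0) !mulr0n subrr mul0r.
move=> + A1 A0; rewrite A1 A0 subrr => /esym/eqP; rewrite mulf_eq0 (negbTE F2) /=.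
by rewrite /cofactor A0E /= addn0 expr0 mul1r (negbTE b0).
Qed.

End Cayley.

(** * Dimension and degree of the orthogonal group *)

Section CayleyChart.
Variable F : fieldType.
Hypothesis F2 : (2 : F) != 0.
Variable k : nat.
Notation d := #|{: upper_pair k}|.

Definition generic_skew : 'M[{mpoly F[d]}]_k := skew_of (fun t => 'X_t).

(** The inverse in the Cayley transform is the adjugate over the determinant. *)
Definition cayley_num := (1%:M - generic_skew) *m \adj (1%:M + generic_skew).

Definition cayley_den := \det (1%:M + generic_skew).

Lemma meval_generic_skew s : map_mx (meval s) generic_skew = skew_of s.
Proof.
rewrite map_skew_of; apply/matrixP=> i j; rewrite !mxE.
by case: insub => [t|]; [|case: insub => [t|] //]; rewrite /= mevalXU.
Qed.

Lemma meval_cayley_den s : cayley_den.@[s] = \det (1%:M + skew_of s).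
Proof. by rewrite -det_map_mx map_mxD map_mx1 meval_generic_skew. Qed.

Lemma rational_map_cayley s : cayley_den.@[s] != 0 ->
  rational_map cayley_num cayley_den s = cayley (skew_of s).
Proof.
move=> ds; have ud : 1%:M + skew_of s \in unitmx by rewrite unitmxE unitfE -meval_cayley_den.
have -> : rational_map cayley_num cayley_den s =
    (cayley_den.@[s])^-1 *: map_mx (meval s) cayley_num.
  by apply/matrixP=> i j; rewrite !mxE mulrC.
rewrite map_mxM map_mx_adj map_mxB map_mxD map_mx1 meval_generic_skew.
by rewrite /cayley /invmx ud -scalemxAr meval_cayley_den.
Qed.

(** One Cayley chart for each diagonal matrix D of signs: D (1 - S)(1 + S)^-1. *)
Lemma orthogonal_rational_cover : rational_cover (orthogonal_group F k) d.
Proof.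
pose D (b : {ffun 'I_k -> bool}) : 'M[F]_k := diag_mx (\row_i (-1) ^+ b i).
exists {ffun 'I_k -> bool}, (fun b => map_mx (@mpolyC d F) (D b) *m cayley_num),
  (fun=> cayley_den) => Q OQ.
have [b0 b0P] := det_add_signs F2 Q; pose b := [ffun i => b0 i].
have DD : D b *m D b = 1%:M.
  rewrite mulmx_diag -diag_const_mx; congr diag_mx; apply/rowP=> i.
  by rewrite !mxE -expr2 sqrr_sign.
have DT : (D b)^T = D b by rewrite tr_diag_mx.
have uDQ : 1%:M + D b *m Q \in unitmx.
  have -> : 1%:M + D b *m Q = D b *m (diag_mx (\row_i (-1) ^+ b0 i) + Q).
    rewrite mulmxDr; congr (_ + _); rewrite -DD; congr (_ *m diag_mx _).
    by apply/rowP=> i; rewrite !mxE ffunE.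
  rewrite unitmx_mul [_ + Q \in _]unitmxE unitfE b0P andbT.
  by have /mulmx1_unit[] := DD.
have ODQ : orthogonal_group F k (D b *m Q).
  by rewrite /orthogonal_group /stiefel /= trmx_mul DT -mulmxA (mulmxA (D b)) DD mul1mx.
have Sskew := cayley_skew ODQ uDQ.
have SE := skew_ofP F2 Sskew; set s := (fun t => _) in SE.
have ds : cayley_den.@[s] != 0.
  rewrite meval_cayley_den -SE -unitfE -unitmxE; exact: unitmx_add1_cayley.
exists b, s; split=> //.
by rewrite rational_map_mulC rational_map_cayley // -SE cayleyK // mulmxA DD mul1mx.
Qed.

End CayleyChart.

Section OrthogonalGroup.
Variable F : closedFieldType.
Hypothesis F2 : (2 : F) != 0.
Variable k : nat.
Notation d := #|{: upper_pair k}|.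

Lemma cayley_den0 : (cayley_den F k).@[fun=> 0] = 1.
Proof.
rewrite meval_cayley_den -[RHS](det1 F k); congr (\det _).
rewrite -[RHS]addr0; congr (_ + _); apply/matrixP=> i j; rewrite !mxE.
by case: insub => [t|] //; case: insub => [t|]; rewrite ?oppr0.
Qed.

(** Let the entries of S with index at least i vanish.  The inclusions are strict
  because the Cayley transform is an involution: the entries of S are, up to the
  nonzero factor det(1 + Q), polynomials in Q = cayley S, and the entry of index i
  vanishes on the i-th set but not on the next one. *)
Lemma orthogonal_zchain : zchain (orthogonal_group F k) d.
Proof.
pose L i := [set s : 'I_d -> F | forall j : 'I_d, (i <= j)%N -> s j = 0].
pose G i := [set rational_map (cayley_num F k) (cayley_den F k) s |
               s in [set s | L i s /\ (cayley_den F k).@[s] != 0]].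
have GO i : G i `<=` orthogonal_group F k.
  move=> _ [s [_ ds] <-]; rewrite rational_map_cayley //; apply: cayley_orthogonal.
    exact: skew_of_trmx.
  by rewrite unitmxE unitfE -meval_cayley_den.
have coordE (t : 'I_d) (s : 'I_d -> F) : (cayley_den F k).@[s] != 0 ->
    let Q := rational_map (cayley_num F k) (cayley_den F k) s in
    let V := var_mx F k k in
    pval Q (((1%:M - V) *m \adj (1%:M + V)) (val (enum_val t)).1 (val (enum_val t)).2) =
    \det (1%:M + Q) * s t /\ \det (1%:M + Q) != 0.
  move=> ds Q V.
  have ud : 1%:M + skew_of s \in unitmx by rewrite unitmxE unitfE -meval_cayley_den.
  have QE : Q = cayley (skew_of s) by apply: rational_map_cayley.
  have uQ : 1%:M + Q \in unitmx by rewrite QE unitmx_add1_cayley.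
  split; last by rewrite -unitfE -unitmxE.
  have : map_mx (pval Q) ((1%:M - V) *m \adj (1%:M + V)) = \det (1%:M + Q) *: skew_of s.
    rewrite map_mxM map_mx_adj map_mxB map_mxD map_mx1 [map_mx _ V]pmap_var.
    rewrite -(cayleyK F2 ud) -QE /cayley scalemxAr; congr (_ *m _).
    by rewrite /invmx uQ scalerA mulfV ?scale1r // -unitfE -unitmxE.
  by move/matrixP/(_ (val (enum_val t)).1 (val (enum_val t)).2);
     rewrite [LHS]mxE [RHS]mxE skew_of_upper.
exists (fun i => zclosure (G i)); split=> i id.
  split; first exact: zclosed_zclosure.
    apply: zirreducible_rational => [v w t Lv Lw j ij|].
      by rewrite Lv // Lw // subr0 mulr0 addr0.
    by exists (fun=> 0) => //; rewrite cayley_den0 oner_eq0.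
  by apply: zclosure_min (@GO i); apply: zclosed_stiefel.
split.
  apply: zclosure_min; first exact: zclosed_zclosure.
  move=> _ [s [Ls ds] <-]; apply: sub_zclosure; exists s => //; split=> // j ij.
  by apply: Ls; apply: ltnW.
(* A point of the next set, on the coordinate line of index i. *)
pose t := Ordinal id; pose e (j : 'I_d) : F := (j == t)%:R.
pose s x (i : 'I_d) : F := 0 + x * (e i - 0).
have [x [dx x0]] : exists x, (cayley_den F k).@[s x] != 0 /\ ('X_t).@[s x] != 0.
  apply: common_nonroot; first by rewrite cayley_den0 oner_eq0.
  by rewrite mevalXU /e eqxx oner_eq0.
move=> subG.
have [] := coordE t (s x) dx; set p := (_ *m _) _ _ => pE dQ.
have : pval (rational_map (cayley_num F k) (cayley_den F k) (s x)) p = 0.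
  have /subG : zclosure (G i.+1) (rational_map (cayley_num F k) (cayley_den F k) (s x)).
    apply: sub_zclosure; exists (s x) => //; split=> // j ij.
    by rewrite /s /e -val_eqE /= gtn_eqF // subrr mulr0 addr0.
  by apply=> _ [s' [Ls' ds'] <-]; have [-> _] := coordE t s' ds'; rewrite Ls' ?mulr0.
move/eqP; rewrite pE mulf_eq0 (negbTE dQ) /=.
by move: x0; rewrite mevalXU => /negbTE ->.
Qed.

Lemma orthogonal_has_dim : has_dim (orthogonal_group F k) 'C(k, 2).
Proof.
rewrite -card_upper_pair; split; first exact: orthogonal_zchain.
by move=> e; apply/zchain_le/orthogonal_rational_cover.
Qed.

Lemma orthogonal_has_degree : exists e, has_degree (orthogonal_group F k) e.
Proof.
have := @has_degree_exists F k k d k k ((var_mx F k k)^T *m var_mx F k k - 1%:M).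
rewrite -stiefelE; apply; first exact: orthogonal_rational_cover.
by rewrite card_upper_pair; exact: orthogonal_has_dim.
Qed.

End OrthogonalGroup.

(** * Critical points *)

Section Gradient.
Variable F : fieldType.

Lemma mderivXU n (i j : 'I_n) : ('X_j : {mpoly F[n]})^`M(i) = (j == i)%:R.
Proof.
rewrite mderivX mnmE; case: eqVneq => [->|_]; last by rewrite scale0r.
rewrite scale1r; have -> : (U_(i) - U_(i))%MM = 0%MM by apply/mnmP=> l; rewrite !mnmE subnn.
by rewrite mpolyX0.
Qed.

Lemma mxvec_index_eq m n (i i' : 'I_m) (j j' : 'I_n) :
  (mxvec_index i j == mxvec_index i' j') = (i == i') && (j == j').
Proof.
by rewrite /mxvec_index (inj_eq (@cast_ord_inj _ _ _)) (inj_eq enum_rank_inj).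
Qed.

(** The objective is a sum of the entries of X^T A X, and the constraints are the
  entries of X^T X - 1, so this is the only derivative to compute. *)
Lemma gradient_quadratic n k (A : 'M[F]_n) a b (Z : 'M[F]_(n, k)) :
  gradient (((var_mx F n k)^T *m map_mx (@mpolyC (n * k) F) A *m var_mx F n k) a b) Z =
  A *m Z *m delta_mx b a + A^T *m Z *m delta_mx a b.
Proof.
apply/matrixP=> i j; rewrite mxE.
have delta_r (M : 'M[F]_(n, k)) c c' : (M *m delta_mx c c') i j = M i c * (j == c')%:R.
  rewrite !mxE (bigD1 c) //= big1 ?addr0; first by rewrite mxE eqxx.
  by move=> l lc; rewrite mxE (negbTE lc) mulr0.
rewrite [RHS]mxE !delta_r.
have -> : ((var_mx F n k)^T *m map_mx (@mpolyC (n * k) F) A *m var_mx F n k) a b =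
    \sum_s \sum_r (A r s)%:MP * ('X_(mxvec_index r a) * 'X_(mxvec_index s b)).
  rewrite mxE; apply: eq_bigr => s _; rewrite mxE mulr_suml; apply: eq_bigr => r _.
  by rewrite !mxE mulrA; congr (_ * _); rewrite mulrC.
transitivity (\sum_s \sum_r A r s *
    (((r == i) && (a == j))%:R * Z s b + Z r a * ((s == i) && (b == j))%:R)).
  rewrite (raddf_sum (mderiv (mxvec_index i j))) raddf_sum; apply: eq_bigr => s _.
  rewrite (raddf_sum (mderiv (mxvec_index i j))) raddf_sum; apply: eq_bigr => r _.
  rewrite /= mderiv_mulC mderivM !mderivXU !mxvec_index_eq.
  by rewrite rmorphM rmorphD !rmorphM !rmorph_nat /= !pvalX [pval _ _%:MP]mevalC.
under eq_bigr => s _ do under eq_bigr => r _ do rewrite mulrDr.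
under eq_bigr => s _ do rewrite big_split /=.
rewrite big_split /=; congr (_ + _).
  rewrite [(A *m Z) i b]mxE mulr_suml; apply: eq_bigr => s _.
  rewrite (bigD1 i) //= big1 ?addr0 ?eqxx /=; first by rewrite (eq_sym j) mulrA mulrAC.
  by move=> r /negbTE ->; rewrite mul0r mulr0.
rewrite (bigD1 i) //= [X in _ + X]big1 ?addr0; last first.
  by move=> s /negbTE si; rewrite big1 // => r _; rewrite si !mulr0.
rewrite [(A^T *m Z) i a]mxE mulr_suml; apply: eq_bigr => r _.
by rewrite eqxx mxE (eq_sym j) mulrA.
Qed.

Lemma gradientB n k (p q : {mpoly F[n * k]}) (Z : 'M[F]_(n, k)) :
  gradient (p - q) Z = gradient p Z - gradient q Z.
Proof. by apply/matrixP=> i j; rewrite !mxE mderivB rmorphB. Qed.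

Lemma gradient_sum n k (I : Type) (s : seq I) (p : I -> {mpoly F[n * k]}) (Z : 'M[F]_(n, k)) :
  gradient (\sum_(i <- s) p i) Z = \sum_(i <- s) gradient (p i) Z.
Proof.
apply/matrixP=> i j; rewrite mxE summxE (raddf_sum (mderiv (mxvec_index i j))) raddf_sum.
by apply: eq_bigr => c _; rewrite mxE.
Qed.

Lemma gradient_objective n k (A : 'M[F]_n) (Z : 'M[F]_(n, k)) :
  A^T = A -> gradient (objective k A) Z = (A *m Z) *+ 2.
Proof.
move=> AT; rewrite gradient_sum; under eq_bigr => a _ do rewrite gradient_quadratic AT.
rewrite big_split /= -mulmx_sumr mulr2n.
suff -> : \sum_(a < k) delta_mx a a = 1%:M :> 'M[F]_k by rewrite mulmx1.
by rewrite -diag_const_mx diag_mx_sum_delta; apply: eq_bigr => a _; rewrite mxE scale1r.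
Qed.

Lemma gradient_constraint n k a b (Z : 'M[F]_(n, k)) :
  gradient (constraint F n a b) Z = Z *m (delta_mx b a + delta_mx a b).
Proof.
rewrite /constraint.
have -> : ((var_mx F n k)^T *m var_mx F n k - 1%:M) a b =
    ((var_mx F n k)^T *m map_mx (@mpolyC (n * k) F) 1%:M *m var_mx F n k) a b -
    (a == b)%:R by rewrite map_mx1 mulmx1 !mxE.
rewrite gradientB gradient_quadratic trmx1 !mul1mx -mulmxDr -[RHS]subr0; congr (_ - _).
by apply/matrixP=> i j; rewrite !mxE -mpolyC_nat mderivC raddf0.
Qed.

(** The span of the gradients of the constraints is the image of this linear map. *)
Definition sym_tangent n k (Z : 'M[F]_(n, k)) (S : 'M[F]_k) := Z *m (S + S^T).

Lemma sym_tangent_is_linear n k (Z : 'M[F]_(n, k)) : linear (sym_tangent Z).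
Proof.
move=> c S T; rewrite /sym_tangent scalemxAr -mulmxDr; congr (_ *m _).
by rewrite linearP /= scalerDr addrACA.
Qed.

HB.instance Definition _ n k (Z : 'M[F]_(n, k)) :=
  GRing.isLinear.Build F 'M[F]_k 'M[F]_(n, k) _ (sym_tangent Z) (sym_tangent_is_linear Z).

(** Lagrange's condition is 2 A Z = Z (C + C^T) for some C. *)
Lemma critical_pointsP n k (A : 'M[F]_n) (Z : 'M[F]_(n, k)) :
    (2 : F) != 0 -> A^T = A ->
  critical_points k A Z <->
  stiefel Z /\ exists2 S : 'M[F]_k, S^T = S & A *m Z = Z *m S.
Proof.
move=> F2 AT; rewrite /critical_points /= gradient_objective //.
set X := [seq _ | _ : _].
have tangentE : <<X>>%VS = (linfun (sym_tangent Z) @: fullv)%VS.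
  apply/eqP; rewrite eqEsubv; apply/andP; split.
    apply/span_subvP => _ /mapP[[a b] _ ->] /=; apply/memv_imgP.
    by exists (delta_mx b a); rewrite ?memvf // lfunE /= gradient_constraint /sym_tangent trmx_delta.
  apply/subvP => _ /memv_imgP[S _ ->]; rewrite lfunE (matrix_sum_delta S) !linear_sum.
  apply: memv_suml => a _; rewrite linear_sum; apply: memv_suml => b _.
  rewrite linearZ; apply: memvZ => /=; apply: memv_span.
  apply/mapP; exists (b, a); first by rewrite mem_enum.
  by rewrite gradient_constraint /sym_tangent trmx_delta.
rewrite tangentE; split=> -[ZZ]; split=> //.
  have /memv_imgP[S _] := b; rewrite lfunE /= /sym_tangent => AZ.
  exists (2^-1 *: (S + S^T)); first by rewrite linearZ /= linearD /= trmxK addrC.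
  by rewrite -scalemxAr -AZ -scaler_nat scalerA mulVf // scale1r.
case: b => S ST AZ; apply/memv_imgP; exists S; rewrite ?memvf // lfunE /= /sym_tangent ST.
by rewrite mulmxDr AZ mulr2n.
Qed.

End Gradient.

(** * Critical points in an orthonormal eigenbasis *)

Section Eigenbasis.
Variable F : numFieldType.
Variables (n k : nat) (A : 'M[F]_n) (u : 'I_n -> 'cV[F]_n) (l : 'I_n -> F).
Hypothesis u_orth : forall i j, (u i)^T *m u j = (i == j)%:R%:M.
Hypothesis u_eigen : forall i, A *m u i = l i *: u i.

Definition basis_mx : 'M[F]_n := \matrix_(r, i) u i r 0.

Lemma basis_mxTK : basis_mx^T *m basis_mx = 1%:M.
Proof.
apply/matrixP=> i j; have /matrixP/(_ 0 0) := u_orth i j; rewrite !mxE mulr1n => <-.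
by apply: eq_bigr => r _; rewrite !mxE.
Qed.

Lemma basis_mxKT : basis_mx *m basis_mx^T = 1%:M.
Proof. exact/mulmx1C/basis_mxTK. Qed.

Lemma mul_basis_mx : A *m basis_mx = basis_mx *m diag_mx (\row_i l i).
Proof.
apply/matrixP=> r i; have /matrixP/(_ r 0) := u_eigen i; rewrite !mxE => e.
rewrite [RHS](bigD1 i) //= [X in _ = _ + X]big1 ?addr0; last first.
  by move=> j /negbTE ji; rewrite !mxE ji mulr0.
by rewrite !mxE eqxx mulr1n mulrC -e; apply: eq_bigr => s _; rewrite !mxE.
Qed.

Lemma eigenbasis_symmetric : A^T = A.
Proof.
have -> : A = basis_mx *m diag_mx (\row_i l i) *m basis_mx^T.
  by rewrite -mul_basis_mx -mulmxA basis_mxKT mulmx1.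
by rewrite !trmx_mul trmxK tr_diag_mx mulmxA.
Qed.

(** The column index behind the j-th column of columns_of, without its default
  value. *)
Definition nth_index (I : {set 'I_n}) (cI : #|I| = k) (j : 'I_k) : 'I_n :=
  enum_val (cast_ord (esym cI) j).

Definition select_mx (I : {set 'I_n}) (cI : #|I| = k) : 'M[F]_(n, k) :=
  \matrix_(i, j) (i == nth_index cI j)%:R.

Lemma nth_index_inj (I : {set 'I_n}) (cI : #|I| = k) : injective (nth_index cI).
Proof. by move=> i j /enum_val_inj/cast_ord_inj. Qed.

Lemma nth_index_in (I : {set 'I_n}) (cI : #|I| = k) j : nth_index cI j \in I.
Proof. exact: enum_valP. Qed.

Lemma nth_index_onto (I : {set 'I_n}) (cI : #|I| = k) i : i \in I -> exists j, nth_index cI j = i.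
Proof.
move=> iI; exists (cast_ord cI (enum_rank_in iI i)).
by rewrite /nth_index cast_ordK enum_rankK_in.
Qed.

Lemma columns_ofE (I : {set 'I_n}) (cI : #|I| = k) : columns_of k u I = basis_mx *m select_mx cI.
Proof.
apply/matrixP=> r j; rewrite !mxE (bigD1 (nth_index cI j)) //= big1 ?addr0.
  rewrite !mxE eqxx mulr1 /nth_index (enum_val_nth r).
  by congr (u _ _ _); apply: set_nth_default; rewrite -cardE cI.
by move=> i /negbTE ij; rewrite !mxE ij mulr0.
Qed.

Lemma select_mxTK (I : {set 'I_n}) (cI : #|I| = k) : (select_mx cI)^T *m select_mx cI = 1%:M.
Proof.
apply/matrixP=> i j; rewrite !mxE (bigD1 (nth_index cI i)) //= big1 ?addr0.
  by rewrite !mxE eqxx mul1r (inj_eq (@nth_index_inj _ _)).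
by move=> s /negbTE si; rewrite !mxE si mul0r.
Qed.

Lemma columns_ofTK (I : {set 'I_n}) : #|I| = k -> (columns_of k u I)^T *m columns_of k u I = 1%:M.
Proof.
move=> cI; rewrite (columns_ofE cI) trmx_mul -mulmxA (mulmxA _ basis_mx) basis_mxTK mul1mx.
exact: select_mxTK.
Qed.

Lemma diag_select_mx (I : {set 'I_n}) (cI : #|I| = k) :
  diag_mx (\row_i l i) *m select_mx cI =
  select_mx cI *m diag_mx (\row_j l (nth_index cI j)).
Proof.
apply/matrixP=> i j; rewrite mul_diag_mx mul_mx_diag !mxE.
by case: eqVneq => [->|_]; rewrite ?mul0r ?mulr0 // mulrC.
Qed.

(** The orthonormal frames of the span of the vectors u_i with i in I. *)
Definition span_frames (I : {set 'I_n}) : set 'M[F]_(n, k) :=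
  [set columns_of k u I *m Q | Q in orthogonal_group F k].

(** If A C = C D, then A (C Q) = (C Q)(Q^T D Q). *)
Lemma span_frames_critical (I : {set 'I_n}) : #|I| = k -> span_frames I `<=` critical_points k A.
Proof.
move=> cI _ [Q OQ <-]; have F2 : (2 : F) != 0 by rewrite pnatr_eq0.
have QQ : Q^T *m Q = 1%:M by [].
apply/critical_pointsP => //; first exact: eigenbasis_symmetric.
split.
  rewrite /stiefel /= trmx_mul -mulmxA (mulmxA _ (columns_of k u I)) columns_ofTK //.
  by rewrite mul1mx.
pose D := diag_mx (\row_j l (nth_index cI j)).
exists (Q^T *m D *m Q); first by rewrite !trmx_mul trmxK tr_diag_mx mulmxA.
rewrite -[RHS]mulmxA (mulmxA Q) (mulmxA Q) (mulmx1C QQ) mul1mx !mulmxA; congr (_ *m _).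
by rewrite (columns_ofE cI) mulmxA mul_basis_mx -!mulmxA diag_select_mx.
Qed.

Lemma select_mxT_row (I : {set 'I_n}) (cI : #|I| = k) (Y : 'M[F]_(n, k)) :
  (forall i, i \notin I -> row i Y = 0) -> select_mx cI *m ((select_mx cI)^T *m Y) = Y.
Proof.
move=> Y0; apply/row_matrixP => i; rewrite row_mul.
have [iI|iI] := boolP (i \in I); last first.
  rewrite Y0 //; suff -> : row i (select_mx cI) = 0 by rewrite mul0mx.
  apply/rowP=> j; rewrite !mxE; case: eqVneq iI => // ->.
  by rewrite nth_index_in.
have [j <-] := nth_index_onto cI iI.
apply/rowP=> c; rewrite !mxE (bigD1 j) //= big1 ?addr0.
  rewrite !mxE eqxx mul1r (bigD1 (nth_index cI j)) //= big1 ?addr0.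
    by rewrite !mxE eqxx mul1r.
  by move=> s /negbTE si; rewrite !mxE si mul0r.
move=> j' /negbTE j'j; rewrite !mxE (inj_eq (@nth_index_inj _ _)).
by rewrite eq_sym j'j mul0r.
Qed.

(** In eigencoordinates Y = U^T Z, the relation A Z = Z S makes D Y Y^T
  symmetric, so the projector P = Y Y^T commutes with D and is diagonal.  The
  entries of P are 0 or 1 and sum to k, and the rows of Y = P Y with P_ii = 0
  vanish. *)
Lemma critical_span_frames Z : injective l -> critical_points k A Z ->
  exists2 I : {set 'I_n}, #|I| = k & span_frames I Z.
Proof.
move=> l_inj /critical_pointsP[]; [by rewrite pnatr_eq0|exact: eigenbasis_symmetric|].
move=> ZZ [S ST AZ]; pose D := diag_mx (\row_i l i).
have UA : basis_mx^T *m A = D *m basis_mx^T.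
  have : (A *m basis_mx)^T = (basis_mx *m D)^T by rewrite mul_basis_mx.
  by rewrite !trmx_mul /D tr_diag_mx eigenbasis_symmetric.
pose Y := basis_mx^T *m Z.
have ZY : Z = basis_mx *m Y by rewrite mulmxA basis_mxKT mul1mx.
have YY : Y^T *m Y = 1%:M.
  by rewrite /Y trmx_mul trmxK -mulmxA (mulmxA basis_mx) basis_mxKT mul1mx.
have DY : D *m Y = Y *m S by rewrite /Y mulmxA -UA -mulmxA AZ mulmxA.
(* From here on Y is only known through these three relations. *)
move: Y ZY YY DY => Y ZY YY DY; pose P := Y *m Y^T.
have DP : D *m P = P *m D.
  have YSY : (Y *m S *m Y^T)^T = Y *m S *m Y^T by rewrite !trmx_mul trmxK ST mulmxA.
  have PT : P^T = P by rewrite /P trmx_mul trmxK.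
  have DPE : D *m P = Y *m S *m Y^T by rewrite mulmxA DY.
  by rewrite {1}DPE -YSY -DPE trmx_mul PT /D tr_diag_mx.
have PY : P *m Y = Y by rewrite -mulmxA YY mulmx1.
have PP : P *m P = P by rewrite {2}/P mulmxA PY.
have trP : \tr P = k%:R by rewrite mxtrace_mulC YY mxtrace1.
move: P DP PY PP trP => P DP PY PP trP.
have P_diag i j : i != j -> P i j = 0.
  move=> ij; have /matrixP/(_ i j) := DP.
  rewrite mul_diag_mx mul_mx_diag !mxE mulrC => /eqP.
  rewrite -subr_eq0 -mulrBr mulf_eq0 subr_eq0 (inj_eq l_inj) (negbTE ij) orbF.
  by move/eqP.
have PYE i j : (P *m Y) i j = P i i * Y i j.
  by rewrite mxE (bigD1 i) //= big1 ?addr0 // => s si; rewrite P_diag 1?eq_sym ?mul0r.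
have P01 i : P i i = 0 \/ P i i = 1.
  have /matrixP/(_ i i) := PP; rewrite mxE (bigD1 i) //= big1 ?addr0; last first.
    by move=> s si; rewrite P_diag 1?eq_sym ?mul0r.
  have [->|Pi0] := eqVneq (P i i) 0; first by left.
  by move=> e; right; apply: (mulfI Pi0); rewrite e mulr1.
pose I := [set i | P i i == 1]%SET.
have cI : #|I| = k.
  apply/eqP; rewrite -(eqr_nat F); apply/eqP.
  rewrite -trP -sum1_card natr_sum big_mkcond; apply: eq_bigr => i _.
  by rewrite inE; have [-> | ->] := P01 i; rewrite ?eqxx // eq_sym oner_eq0.
have Y0 i : i \notin I -> row i Y = 0.
  rewrite inE => Pi; apply/rowP=> j; rewrite [LHS]mxE [RHS]mxE -PY PYE.
  by have [->|P1] := P01 i; rewrite ?mul0r // P1 eqxx in Pi *.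
have CQ : columns_of k u I *m ((select_mx cI)^T *m Y) = Z.
  by rewrite (columns_ofE cI) -mulmxA select_mxT_row.
exists I => //; exists ((select_mx cI)^T *m Y) => //.
rewrite /orthogonal_group /stiefel /=.
rewrite trmx_mul trmxK -mulmxA select_mxT_row //.
Qed.

(** An eigenvector u_i with i in I but not in J would be orthogonal to the columns
  of the frame, while these span u_i. *)
Lemma span_frames_disjoint (I J : {set 'I_n}) : #|I| = k -> #|J| = k ->
  (span_frames I `&` span_frames J) !=set0 -> I = J.
Proof.
move=> cI cJ [Z [ZI ZJ]].
have incl (I1 J1 : {set 'I_n}) : #|I1| = k -> #|J1| = k -> span_frames I1 Z ->
    span_frames J1 Z -> I1 \subset J1.
  move=> c1 c2 [Q1 OQ1 Z1] [Q2 OQ2 Z2]; apply/fintype.subsetP => i iI; apply: contraT => iJ.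
  have [j ji] := nth_index_onto c1 iI.
  have /(congr1 (mulmx basis_mx^T)) :
      columns_of k u I1 *m Q1 = columns_of k u J1 *m Q2 by rewrite Z1.
  rewrite (columns_ofE c1) (columns_ofE c2) -!mulmxA !(mulmxA basis_mx^T) basis_mxTK !mul1mx.
  have Q1Q : Q1 *m Q1^T = 1%:M by apply: mulmx1C.
  move=> /(congr1 (mulmx^~ Q1^T)); rewrite -!mulmxA Q1Q mulmx1 => /matrixP/(_ i j).
  rewrite !mxE -ji eqxx big1 => [/eqP|s _]; first by rewrite oner_eq0.
  rewrite !mxE; case: eqVneq => [e|_]; last by rewrite mul0r.
  by rewrite -ji e nth_index_in in iJ.
by apply/eqP; rewrite finset.eqEsubset !incl.
Qed.

End Eigenbasis.
Arguments span_frames {F n} k u I.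

(** * Simple spectrum *)

Section SimpleSpectrum.
Variable F : fieldType.
Variable n : nat.
Implicit Type A : 'M[F]_n.+1.

Lemma char_poly_conj A (P : 'M[F]_n.+1) (l : 'I_n.+1 -> F) :
    P \in unitmx -> A = P *m diag_mx (\row_i l i) *m invmx P ->
  char_poly A = \prod_i ('X - (l i)%:P).
Proof.
move=> uP ->; set D := diag_mx _.
transitivity (char_poly D); last first.
  rewrite char_poly_trig ?diag_mx_is_trig //; apply: eq_bigr => i _.
  by rewrite !mxE eqxx.
rewrite /char_poly.
have -> : char_poly_mx (P *m D *m invmx P) =
    map_mx polyC P *m char_poly_mx D *m map_mx polyC (invmx P).
  rewrite /char_poly_mx mulmxBr mulmxBl !map_mxM; congr (_ - _).
  by rewrite scalar_mxC -mulmxA -map_mxM mulmxV // map_mx1 mulmx1.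
by rewrite !det_mulmx mulrAC -det_mulmx -map_mxM mulmxV // map_mx1 det1 mul1r.
Qed.

(** For p the characteristic polynomial, det p'(A) is the product of the values of
  p' at the eigenvalues: up to sign, the discriminant of p. *)
Definition discriminant_mx (K : comNzRingType) (A : 'M[K]_n.+1) : K :=
  \det (horner_mx A (char_poly A)^`()).

Lemma discriminant_mx_conj A (P : 'M[F]_n.+1) (l : 'I_n.+1 -> F) :
    P \in unitmx -> A = P *m diag_mx (\row_i l i) *m invmx P ->
  discriminant_mx A = \prod_i \prod_(j | j != i) (l i - l j).
Proof.
move=> uP AE; rewrite /discriminant_mx [X in horner_mx X _]AE.
rewrite [horner_mx _ _](horner_mx_uconj _ _ uP) horner_mx_diag !det_mulmx.
rewrite mulrAC -det_mulmx mulmxV //.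
rewrite det1 mul1r det_diag; apply: eq_bigr => i _.
rewrite !mxE (char_poly_conj uP AE) (bigD1 i) //= derivM derivXsubC mul1r.
rewrite hornerD hornerM hornerXsubC subrr mul0r addr0 horner_prod.
by apply: eq_bigr => j _; rewrite hornerXsubC.
Qed.

Lemma discriminant_mx_neq0 A (P : 'M[F]_n.+1) (l : 'I_n.+1 -> F) :
    P \in unitmx -> A = P *m diag_mx (\row_i l i) *m invmx P ->
  reflect (injective l) (discriminant_mx A != 0).
Proof.
move=> uP AE; rewrite (discriminant_mx_conj uP AE); apply: (iffP idP) => [|l_inj].
  move/prodf_neq0 => l_neq i j lij; apply/eqP; have := l_neq j isT.
  apply: contraNT => ij; apply/prodf_eq0; exists i => //.
  by rewrite lij subrr.
apply/prodf_neq0 => i _; apply/prodf_neq0 => j ji.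
by rewrite subr_eq0 (inj_eq l_inj) eq_sym.
Qed.

End SimpleSpectrum.

Lemma map_discriminant_mx n (K L : comNzRingType) (f : {rmorphism K -> L}) (A : 'M[K]_n.+1) :
  f (discriminant_mx A) = discriminant_mx (map_mx f A).
Proof.
by rewrite /discriminant_mx -det_map_mx map_horner_mx -deriv_map map_char_poly.
Qed.

(** The discriminant is a polynomial in the entries, and it does not vanish at
  diag(0, ..., n). *)
Lemma generic_simple_spectrum (R : realType) n (P : 'M[R]_n.+1 -> Prop) :
  (forall A, A^T = A -> discriminant_mx A != 0 -> P A) ->
  generically (symmetric_mx R n.+1) P.
Proof.
move=> HP; exists [set A | pval A (discriminant_mx (var_mx R n.+1 n.+1)) = 0].
have discE A : pval A (discriminant_mx (var_mx R n.+1 n.+1)) = discriminant_mx A.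
  by rewrite map_discriminant_mx [map_mx _ _]pmap_var.
split; first exact: zclosed_poly.
  pose l (i : 'I_n.+1) : R := i%:R.
  have l_inj : injective l by move=> i j /eqP; rewrite eqr_nat => /eqP/val_inj.
  move=> /(_ (diag_mx (\row_i l i))) /=; rewrite discE => /(_ (tr_diag_mx _))/eqP.
  have DE : diag_mx (\row_i l i) = 1%:M *m diag_mx (\row_i l i) *m invmx 1%:M.
    by rewrite invmx1 mul1mx mulmx1.
  exact/negP/(discriminant_mx_neq0 (unitmx1 _ _) DE).
by move=> A AT /eqP; rewrite discE; apply: HP.
Qed.

Section RealSpectral.
Variable R : realType.
Variable n : nat.
Implicit Type A : 'M[R]_n.+1.

Lemma complexify_hermitian A : A^T = A -> complexify A \is hermsymmx.
Proof.
move=> AT; apply/is_hermitianmxP; rewrite expr0 scale1r; apply/matrixP=> i j.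
by rewrite !mxE -{1}AT mxE; apply/eqP; rewrite eq_complex /= oppr0 !eqxx.
Qed.

(** The complexification of a real symmetric matrix is Hermitian. *)
Lemma real_spectral A : A^T = A -> exists (P : 'M[R[i]]_n.+1) (r : 'I_n.+1 -> R),
  P \in unitmx /\ complexify A = P *m diag_mx (\row_i (r i)%:C%C) *m invmx P.
Proof.
move=> AT; have Ah := complexify_hermitian AT.
have /orthomx_spectralP := hermitian_normalmx Ah.
set P := spectralmx _; set d := spectral_diag _ => AE.
have uP : P \in unitmx by apply: spectral_unit.
exists (invmx P), (fun i => complex.Re (d 0 i)); split; first by rewrite unitmx_inv.
rewrite invmxK AE; congr (_ *m diag_mx _ *m _); apply/rowP=> i; rewrite mxE RRe_real //.
by have /mxOverP := hermitian_spectral_diag_real Ah; apply.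
Qed.

(** The eigenvalues are real and simple; eigenvectors of distinct eigenvalues are
  orthogonal, and positivity of the real dot product allows to normalize them. *)
Lemma orthonormal_eigenbasis_exists A : A^T = A -> discriminant_mx A != 0 ->
  exists u, orthonormal_eigenbasis A u.
Proof.
move=> AT; have [P [r [uP AE]]] := real_spectral AT.
rewrite -(fmorph_eq0 (real_complex R)) map_discriminant_mx.
move=> /(discriminant_mx_neq0 uP AE) rC_inj.
have r_inj : injective r by move=> i j rij; apply: rC_inj; rewrite rij.
have /choice[v vP] (i : 'I_n.+1) : exists v : 'rV[R]_n.+1, v *m A = r i *: v /\ v != 0.
  have /eigenvalueP[v vA v0] : eigenvalue A (r i); last by exists v.
  rewrite eigenvalue_root_char -(fmorph_root (real_complex R)) map_char_poly.
  by rewrite (char_poly_conj uP AE) (bigD1 i) //= rootM root_XsubC eqxx.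
have dot_gt0 i : 0 < (v i *m (v i)^T) 0 0.
  have [_ /rV0Pn[j vj]] := vP i; rewrite mxE lt_def; apply/andP; split.
    apply: contra_neq vj => /eqP; rewrite psumr_eq0; last first.
      by move=> c _; rewrite mxE -expr2 sqr_ge0.
    by move/allP/(_ j (mem_index_enum _)); rewrite mxE -expr2 sqrf_eq0 => /eqP.
  by apply: sumr_ge0 => c _; rewrite mxE -expr2 sqr_ge0.
have dot0 i j : i != j -> (v i *m (v j)^T) 0 0 = 0.
  move=> ij; have [vi _] := vP i; have [vj _] := vP j.
  have : r i *: (v i *m (v j)^T) = r j *: (v i *m (v j)^T).
    by rewrite scalemxAl -vi -mulmxA -[X in X *m (v j)^T]AT -trmx_mul vj linearZ /= -scalemxAr.
  move/eqP; rewrite -subr_eq0 -scalerBl scaler_eq0 subr_eq0 (inj_eq r_inj) (negbTE ij) /=.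
  by move=> /eqP ->; rewrite mxE.
exists (fun i => (Num.sqrt ((v i *m (v i)^T) 0 0))^-1 *: (v i)^T); split=> [i j|i].
  have trZ c (w : 'cV[R]_n.+1) : (c *: w)^T = c *: w^T by exact: linearZ.
  rewrite trZ trmxK -scalemxAl -scalemxAr scalerA.
  rewrite [v i *m (v j)^T]mx11_scalar scale_scalar_mx; congr (_%:M).
  have [<-|ij] := eqVneq i j; last by rewrite (dot0 _ _ ij) mulr0.
  by rewrite -invfM -expr2 sqr_sqrtr ?ltW // mulVf // gt_eqF.
have Av : A *m (v i)^T = r i *: (v i)^T.
  have [/(congr1 trmx)] := vP i; rewrite trmx_mul AT => -> _; exact: linearZ.
by exists (r i); rewrite -scalemxAr Av scalerA mulrC -scalerA.
Qed.

End RealSpectral.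

(** * The components of the critical set *)

Section SlicePullback.
Variable F : fieldType.
Variables m p q : nat.

(** The action on equations of slices of the substitution of C Q for a point. *)
Definition slice_mul (C : 'M[F]_(p, m)) : 'M[F]_(1 + m * q, 1 + p * q) :=
  block_mx 1%:M 0 0 (lin_mx (mulmx C)).

Lemma slice_mulE d (W : 'M[F]_(1 + p * q, d)) C (Q : 'M[F]_(m, q)) :
  slice W (C *m Q) <-> slice (slice_mul C *m W) Q.
Proof.
rewrite /slice /= mulmxA mul_row_block mulmx1 !mulmx0 add0r addr0.
by rewrite mul_vec_lin.
Qed.

End SlicePullback.

Lemma slice_mulK (F : fieldType) m p q (C : 'M[F]_(p, m)) (B : 'M[F]_(m, p)) :
  B *m C = 1%:M -> slice_mul q C *m slice_mul q B = 1%:M.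
Proof.
move=> BC; rewrite /slice_mul mulmx_block !mulmx0 !mul0mx mulmx1 !addr0 !add0r.
suff -> : lin_mx (mulmx C) *m lin_mx (mulmx B) = 1%:M :> 'M[F]_(m * q).
  by rewrite -scalar_mx_block.
apply/row_matrixP => i; rewrite !rowE mulmx1 mulmxA -[delta_mx 0 i]vec_mxK !mul_vec_lin.
by rewrite /= mulmxA BC mul1mx.
Qed.

(** A left inverse of C makes the pullback of equations onto. *)
Lemma generic_slice_mul (F : closedFieldType) m p q d (C : 'M[F]_(p, m)) B
    (P : 'M[F]_(1 + m * q, d) -> Prop) :
  B *m C = 1%:M -> generically [set: 'M[F]_(1 + m * q, d)] P ->
  generically [set: 'M[F]_(1 + p * q, d)] (fun W => P (slice_mul q C *m W)).
Proof.
move=> BC /(generically_pullback (f := mul_var d (slice_mul q C))).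
have surj Y : exists Z, pmap_mx (mul_var d (slice_mul q C)) Z = Y.
  by exists (slice_mul q B *m Y); rewrite pmap_mul_var mulmxA slice_mulK // mul1mx.
by move=> /(_ surj); apply: generically_sub => W; rewrite pmap_mul_var.
Qed.

Lemma zchain_subset (F : fieldType) m n (X Y : set 'M[F]_(m, n)) d :
  X `<=` Y -> zchain X d -> zchain Y d.
Proof.
move=> XY [Z [Zi Zlt]]; exists Z; split=> // i /Zi[Zc Zirr ZX].
by split=> //; apply: subset_trans ZX XY.
Qed.

Section Components.
Variable F : numClosedFieldType.
Variables (n k : nat) (A : 'M[F]_n) (u : 'I_n -> 'cV[F]_n) (l : 'I_n -> F).
Hypothesis u_orth : forall i j, (u i)^T *m u j = (i == j)%:R%:M.
Hypothesis u_eigen : forall i, A *m u i = l i *: u i.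
Hypothesis l_inj : injective l.
Hypothesis kn : (k <= n)%N.
Let subsets := [set I : {set 'I_n} | #|I| = k].
Let F2 : (2 : F) != 0. Proof. by rewrite pnatr_eq0. Qed.

Lemma critical_pointsE :
  critical_points k A = \bigcup_(I in subsets) span_frames k u I.
Proof.
apply/seteqP; split=> [Z /(critical_span_frames u_orth u_eigen l_inj)[I cI IZ]|Z [I cI]].
  by exists I.
exact: span_frames_critical u_orth u_eigen _ cI Z.
Qed.

Lemma trivIset_span_frames : trivIset subsets (span_frames k u).
Proof. by move=> I J cI cJ IJ; apply: (span_frames_disjoint u_orth cI cJ). Qed.

Lemma zclosed_span_frames I : subsets I -> zclosed (span_frames k u I).
Proof. by move=> cI; apply: zclosed_image (columns_ofTK u_orth cI) (@zclosed_stiefel _ _ _). Qed.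

Lemma zisomorphic_span_frames I : subsets I ->
  zisomorphic (span_frames k u I) (orthogonal_group F k).
Proof.
move=> cI; have CC := columns_ofTK u_orth cI.
exists (mul_var k (columns_of k u I)^T), (mul_var k (columns_of k u I)); split.
  by move=> _ [Q OQ <-]; rewrite !pmap_mul_var (mulmxA _ _ Q) CC mul1mx.
by move=> Q OQ; rewrite !pmap_mul_var mulmxA CC mul1mx; split=> //; exists Q.
Qed.

Lemma critical_rational_cover : rational_cover (critical_points k A) 'C(k, 2).
Proof.
rewrite critical_pointsE -card_upper_pair.
by apply: rational_cover_bigcup => I _; apply/rational_cover_image/orthogonal_rational_cover.
Qed.

Lemma card_subsets : #|{: {I : {set 'I_n} | #|I| == k}}| = 'C(n, k).
Proof. by rewrite card_sig -cardsE card_draws card_ord. Qed.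

Lemma critical_has_dim : has_dim (critical_points k A) 'C(k, 2).
Proof.
split; last by move=> e; apply/zchain_le/critical_rational_cover.
have /card_gt0P[[I /eqP cI] _] : (0 < #|{: {I : {set 'I_n} | #|I| == k}}|)%N.
  by rewrite card_subsets bin_gt0.
have [Ochain _] := orthogonal_has_dim F2 k.
apply: zchain_subset (zchain_image (columns_ofTK u_orth cI) Ochain).
by rewrite critical_pointsE => Z IZ; exists I.
Qed.

(** A generic W is generic for each of the finitely many pullbacks to O(k), so W
  meets each component in e points. *)
Lemma critical_has_degree e : has_degree (orthogonal_group F k) e ->
  has_degree (critical_points k A) (e * 'C(n, k)).
Proof.
move=> [d [[Od Omax] Oe]]; have [Ochain Odim] := orthogonal_has_dim F2 k.
have dE : d = 'C(k, 2) by apply/eqP; rewrite eqn_leq Odim // Omax.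
move: Oe; rewrite dE => Oe.
exists 'C(k, 2); split; first exact: critical_has_dim.
pose J := {I : {set 'I_n} | #|I| == k}.
have Je : generically [set: 'M[F]_(1 + n * k, 'C(k, 2))] (fun W =>
    forall I : J, I \in enum {: J} ->
      (orthogonal_group F k `&` slice (slice_mul k (columns_of k u (val I)) *m W) #= `I_e)%card).
  apply: generically_all => -[I /= /eqP cI] _.
  exact: generic_slice_mul (columns_ofTK u_orth cI) Oe.
apply: generically_sub Je => W WJ; rewrite -card_subsets.
pose X (I : J) := span_frames k u (val I) `&` slice W.
have -> : critical_points k A `&` slice W = \bigcup_I X I.
  rewrite critical_pointsE; apply/seteqP; split=> Z.
    by move=> [[I cI IZ] WZ]; exists (Sub I (introT eqP cI)).
  by move=> [[I /= /eqP cI] _ [/= IZ WZ]]; split=> //; exists I.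
apply: card_bigcup_disjoint => [[I /= pI]|[I /= pI] [I' /= pI'] [Z [[IZ _] [IZ' _]]]]; last first.
  by apply/val_inj/(span_frames_disjoint u_orth (eqP pI) (eqP pI')); exists Z.
have CC := columns_ofTK u_orth (eqP pI).
have := WJ (exist _ I pI); rewrite mem_enum => /(_ isT) /=; set Y := _ `&` _ => Ye.
have -> : X (exist _ I pI) = mulmx (columns_of k u I) @` Y.
  apply/seteqP; split=> [_ [[Q OQ <-] /slice_mulE WQ]|_ [Q [OQ /slice_mulE WQ] <-]].
    by exists Q.
  by split=> //; exists Q.
apply: card_eq_trans Ye; apply: inj_card_eq => Q Q' _ _ QQ.
by rewrite -[Q]mul1mx -[Q']mul1mx -CC -!mulmxA QQ.
Qed.

End Components.

(** * Generic real symmetric matrices *)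

Section Complexification.
Variable R : realType.
Variables n k : nat.

Lemma complexify_orthonormal (u : 'I_n -> 'cV[R]_n) :
  (forall i j, (u i)^T *m u j = (i == j)%:R%:M) ->
  forall i j, (complexify (u i))^T *m complexify (u j) = (i == j)%:R%:M.
Proof.
move=> uu i j; rewrite /complexify map_trmx -map_mxM uu map_scalar_mx.
by rewrite rmorph_nat.
Qed.

Lemma complexify_eigen (A : 'M[R]_n) (v : 'cV[R]_n) (l : R) :
  A *m v = l *: v -> complexify A *m complexify v = l%:C%C *: complexify v.
Proof. by move=> Av; rewrite /complexify -map_mxM Av map_mxZ. Qed.

Lemma component_span_frames (u : 'I_n -> 'cV[R]_n) I :
  component k u I = span_frames k (fun i => complexify (u i)) I.
Proof.
have CE : complexify (columns_of k u I) = columns_of k (fun i => complexify (u i)) I.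
  by apply/matrixP=> r j; rewrite !mxE.
by rewrite /component CE.
Qed.

Lemma card_subsets_set : ([set I : {set 'I_n} | #|I| = k] #= `I_('C(n, k)))%card.
Proof.
rewrite -card_subsets -(card_eqr (card_setT_finType _)).
pose J := {I : {set 'I_n} | #|I| == k}.
have -> : [set I : {set 'I_n} | #|I| = k] = (val : J -> _) @` [set: J].
  apply/seteqP; split=> [I cI|_ [[I /= /eqP cI] _ <-] //].
  by exists (Sub I (introT eqP cI)).
by apply: inj_card_eq => I I' _ _; apply: val_inj.
Qed.

End Complexification.

(** The discriminant is the product of the differences of the eigenvalues. *)
Lemma eigenvalues_inj (R : realType) n (A : 'M[R]_n.+1)
    (u : 'I_n.+1 -> 'cV[R]_n.+1) (l : 'I_n.+1 -> R) :
  (forall i j, (u i)^T *m u j = (i == j)%:R%:M) ->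
  (forall i, A *m u i = l i *: u i) -> discriminant_mx A != 0 -> injective l.
Proof.
move=> uu Au discA; have UUT := basis_mxKT uu; have UTU := basis_mxTK uu.
have uU : basis_mx u \in unitmx by have [] := mulmx1_unit UUT.
have UV : invmx (basis_mx u) = (basis_mx u)^T.
  by rewrite -[LHS]mul1mx -UTU -mulmxA mulmxV // mulmx1.
apply: (elimT (discriminant_mx_neq0 uU _) discA).
by rewrite UV -(mul_basis_mx Au) -mulmxA UUT mulmx1.
Qed.

Theorem theorem1p1 (R : realType) (n k : nat) (hk : (1 <= k <= n)%N) :
  generically (symmetric_mx R n) (fun A : 'M[R]_n =>
    let Crit := critical_points k (complexify A) in
    let O := orthogonal_group R[i] k in
    let subsets := [set I : {set 'I_n} | #|I| = k] in
    (exists u, orthonormal_eigenbasis A u) /\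
    (forall u, orthonormal_eigenbasis A u ->
      [/\ Crit = \bigcup_(I in subsets) component k u I,
          trivIset subsets (component k u),
          (subsets #= `I_('C(n, k)))%card &
          forall I, subsets I ->
            zclosed (component k u I) /\ zisomorphic (component k u I) O]) /\
    zclosed Crit /\
    has_dim O 'C(k, 2) /\
    has_dim Crit 'C(k, 2) /\
    (exists e : nat, has_degree O e /\ has_degree Crit (e * 'C(n, k))%N)).
Proof.
case: n hk => [|n] /andP[k0 kn]; first by case: k k0 kn.
apply: generic_simple_spectrum => A AT discA Crit O subsets.
have frames u : orthonormal_eigenbasis A u -> let uC i := complexify (u i) in
    exists lC : 'I_n.+1 -> R[i], [/\ injective lC,
      forall i j, (uC i)^T *m uC j = (i == j)%:R%:M &
      forall i, complexify A *m uC i = lC i *: uC i].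
  move=> [uu /choice[l Au]] uC; exists (fun i => (l i)%:C%C); split.
  - by move=> i j /complexI; apply: (eigenvalues_inj uu Au discA).
  - exact: complexify_orthonormal.
  - by move=> i; apply: complexify_eigen.
have F2 : (2 : R[i]) != 0 by rewrite pnatr_eq0.
have [u uP] := orthonormal_eigenbasis_exists AT discA.
have [lC [l_inj uu Au]] := frames u uP.
split; first by exists u.
split.
  move=> {lC l_inj uu Au} {}u {}uP; have [lC [l_inj uu Au]] := frames u uP.
  have compE : component k u = span_frames k (fun i => complexify (u i)).
    by apply/funext => I; apply: component_span_frames.
  rewrite compE; split; [exact: (critical_pointsE k uu Au l_inj)|exact: trivIset_span_frames|
    exact: card_subsets_set|move=> I cI].
  by split; [exact: zclosed_span_frames|exact: zisomorphic_span_frames].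
split.
  rewrite /Crit (critical_pointsE k uu Au l_inj).
  by apply: zclosed_bigcup => I; apply: zclosed_span_frames.
split; first exact: orthogonal_has_dim.
split; first exact: (critical_has_dim uu Au l_inj kn).
have [e eO] := orthogonal_has_degree F2 k.
by exists e; split=> //; exact: (critical_has_degree uu Au l_inj kn eO).
Qed.
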